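(* For an analytic convex subset $A$ of a Polish vector space $X$, the following conditions are equivalent: (1) $A-A$ is not a neighborhood of zero in $X$; (2) $A-A$ is meager in $X$; (3) $A$ is generically Haar-$1$; (4) $A$ is Haar-thin; (5) $A$ is null-$n$ for some $n\in\mathbb N$. If $A$ is a $G_\delta$-set in $X$, then the conditions (1)--(5) are equivalent to (6) $A$ is null-finite; (7) $A$ is Haar-countable.
   Context: A Polish vector space is a topological linear space over $\mathbb R$ whose underlying topological space is Polish. $\mathbb N=\{1,2,\dots\}$. A space is analytic if it is a continuous image of a Polish space. $A-A=\{a-b:a,b\in A\}$. Smallness notions for $A\subset X$ ($2^\omega=\{0,1\}^\omega$ is the Cantor cube). Generically Haar-$1$: the set $\{f\in C(2^\omega,X):\forall x\in X\;|f^{-1}(A+x)|\le1\}$ is comeager in the space $C(2^\omega,X)$ of continuous maps with the compact-open topology. Haar-thin: there is a continuous $f:2^\omega\to X$ such that for every $x\in X$ the set $f^{-1}(A+x)$ is thin, where $T\subset2^\omega$ is thin if for every $n\in\omega$ the map $T\ni x\mapsto x|_{\omega\setminus\{n\}}$ is injective. Null-finite (resp. null-$n$): there is a continuous map $f:\omega+1\to X$ ($\omega+1$ with the order topology) such that $f^{-1}(A+x)$ is finite (resp. has cardinality at most $n$) for every $x\in X$. Haar-countable: there is a continuous map $f:2^\omega\to X$ such that $f^{-1}(A+x)$ is countable for every $x\in X$. *)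

(* Defs.v *)
From HB Require Import structures.
From mathcomp Require Import all_boot all_order all_algebra.
From mathcomp Require Import all_classical all_reals all_analysis borel_hierarchy.

Set Implicit Arguments.
Unset Strict Implicit.
Unset Printing Implicit Defensive.

Import Order.TTheory GRing.Theory Num.Theory.

Local Open Scope classical_set_scope.
Local Open Scope card_scope.
Local Open Scope ring_scope.

Section Polish.
Variable R : realType.

Definition is_metric (T : Type) (d : T -> T -> R) : Prop :=
  [/\ forall x, d x x = 0,
      forall x y, d x y = 0 -> x = y,
      forall x y, d x y = d y x &
      forall x y z, d x z <= d x y + d y z].

Definition metrizes (T : topologicalType) (d : T -> T -> R) : Prop :=
  forall x : T, nbhs x = nbhs_ball_ (fun y e => [set z | d y z < e]) x.

Definition cauchy_seq (T : Type) (d : T -> T -> R) (u : nat -> T) : Prop :=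
  forall e : R, 0 < e ->
    exists N, forall m n, (N <= m)%N -> (N <= n)%N -> d (u m) (u n) < e.

Definition completely_metrizable (T : topologicalType) : Prop :=
  exists d : T -> T -> R,
    [/\ is_metric d, metrizes d &
        forall u : nat -> T, cauchy_seq d u -> exists l : T, u @ \oo --> l].

Definition separable (T : topologicalType) : Prop :=
  exists2 D : set T, countable D & dense D.

Definition polish (T : topologicalType) : Prop :=
  separable T /\ completely_metrizable T.

(* The empty space is Polish, hence analytic. *)
Definition analytic (T : topologicalType) : Prop :=
  exists P : topologicalType, polish P /\
    exists2 f : P -> T, continuous f & range f = setT.

End Polish.

Definition nowhere_dense (T : topologicalType) (S : set T) : Prop :=
  interior (closure S) = set0.

Definition meager (T : topologicalType) (S : set T) : Prop :=
  exists2 F : (set T)^nat,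
    (forall i, nowhere_dense (F i)) & S `<=` \bigcup_i F i.

Definition comeager (T : topologicalType) (S : set T) : Prop := meager (~` S).

(* C(U, V) with the subspace topology inherited from the compact-open topology
   on all maps U -> V. *)
Definition compact_open_C (U V : topologicalType) : Type :=
  initial_topology (fun f : continuousType U V => f : {compact-open, U -> V}).

HB.instance Definition _ (U V : topologicalType) :=
  Topological.on (compact_open_C U V).

(* The ordinal omega + 1 : None is the largest element. *)
Definition omega_succ : Type := option nat.

HB.instance Definition _ := Choice.on omega_succ.

Definition omega_succ_le (x y : omega_succ) : bool :=
  match x, y with
  | _, None => true
  | None, Some _ => false
  | Some m, Some n => (m <= n)%N
  end.

Definition omega_succ_lt (x y : omega_succ) : bool :=
  (y != x) && omega_succ_le x y.

Lemma omega_succ_le_anti : antisymmetric omega_succ_le.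
Proof. by move=> [m|] [n|] //= /anti_leq ->. Qed.

Lemma omega_succ_le_trans : transitive omega_succ_le.
Proof. by move=> [n|] [m|] [p|] //=; exact: leq_trans. Qed.

Lemma omega_succ_le_total : total omega_succ_le.
Proof. by move=> [m|] [n|] //=; exact: leq_total. Qed.

HB.instance Definition _ := @Order.isOrder.Build Order.default_display omega_succ
  omega_succ_le omega_succ_lt
  (fun x y => if omega_succ_lt x y then x else y)
  (fun x y => if omega_succ_lt x y then y else x)
  (fun _ _ => erefl) (fun _ _ => erefl) (fun _ _ => erefl)
  omega_succ_le_anti omega_succ_le_trans omega_succ_le_total.

Definition translate (V : zmodType) (A : set V) (x : V) : set V :=
  [set a + x | a in A].

Definition diff_set (V : zmodType) (A B : set V) : set V :=
  [set a - b | a in A & b in B].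

Definition thin (T : set cantor_space) : Prop :=
  forall n : nat,
    set_inj T (fun (x : cantor_space) (m : {m : nat | m != n}) => x (sval m)).

Section Smallness.
Variables (R : realType) (X : topologicalLmodType R).
Implicit Type A : set X.

Definition generically_haar1 A : Prop :=
  comeager [set f : compact_open_C cantor_space X |
    forall x : X, (f : continuousType cantor_space X) @^-1` translate A x
                  #<= `I_1].

Definition haar_thin A : Prop :=
  exists2 f : cantor_space -> X, continuous f &
    forall x : X, thin (f @^-1` translate A x).

Definition null_finite A : Prop :=
  exists2 f : order_topology omega_succ -> X, continuous f &
    forall x : X, finite_set (f @^-1` translate A x).

Definition null_n (n : nat) A : Prop :=
  exists2 f : order_topology omega_succ -> X, continuous f &
    forall x : X, f @^-1` translate A x #<= `I_n.

Definition haar_countable A : Prop :=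
  exists2 f : cantor_space -> X, continuous f &
    forall x : X, countable (f @^-1` translate A x).

End Smallness.

(* Main.v *)
Require Import Defs.
From mathcomp Require Import all_boot all_order all_algebra.
From mathcomp Require Import all_classical all_reals all_analysis borel_hierarchy.
Import Order.TTheory GRing.Theory Num.Theory.
From mathcomp Require Import lra zify.
Local Open Scope card_scope.
Local Open Scope classical_set_scope.
Local Open Scope ring_scope.

(** The proof rests on three ideas.

    Pettis' theorem without the Baire property. An analytic set carries a
    Souslin scheme, that is, a tree of sets whose nonempty branches shrink to
    points of the set. If two such sets are of second category at every point
    of a common open set, one can descend along both trees at once without
    losing this property, and the two limit points coincide
    ([souslin_overlap]). Applied to [S] and a small translate of [S], this shows
    that [S - S] is a neighbourhood of zero when [S] is analytic and not meager
    ([souslin_diff_nbhs]). For a convex [A] the difference set of [A - A] is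
    [2 (A - A)], so either [A - A] is meager or it is a neighbourhood of zero.

    Generic maps. If [A - A] is covered by nowhere dense sets [F_i], then the
    maps [f] on the Cantor cube with [f s - f t] in the closure of [F_i] for some
    [s] and [t] that differ in the coordinate [j] form a nowhere dense set
    ([nowhere_dense_differences]). Outside all of these, two distinct points
    are never sent into the same translate of [A]. As the space of continuous
    maps is a Baire space ([comeager_nonempty]), such a map exists; it witnesses
    Haar-thinness and Haar-countability, and restricted to a convergent
    sequence it witnesses nullness.

    Common translates. Conversely let [A - A] be a neighbourhood of zero. For a
    continuous map [f] on the Cantor cube, [f s] and [f t] lie in a common
    translate of [A] as soon as [t] is close enough to [s], in particular for
    some [t] that differs from [s] in one coordinate; this contradicts
    Haar-thinness. An averaging argument moves any [n] sufficiently small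
    vectors into [A] by one translation ([common_translate]), which contradicts
    null-[n]. For a G-delta set [A] this is iterated infinitely often
    ([Gdelta_common_shift]): a set of the form [A - x_1 & ... & A - x_n] whose
    difference set is a neighbourhood of zero can be intersected with one more
    translate, without losing this property and without moving a chosen point
    of it by much ([diff_nbhs_shift]); completeness and the G-delta condition
    provide a limit. Infinitely many terms of a convergent sequence, or a
    dense-in-itself subset of the Cantor cube, are in this way sent into one
    translate of [A]; in the second case the preimage of this translate is a
    G-delta set that contains a dense-in-itself set, hence is uncountable
    ([cantor_uncountable_Gdelta]). *)

Set Implicit Arguments.
Unset Strict Implicit.
Unset Printing Implicit Defensive.

(** * Meager sets *)

Section Meager.
Variable T : topologicalType.
Implicit Types S W : set T.

Lemma meagerS S S' : S `<=` S' -> meager S' -> meager S.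
Proof. by move=> SS' [F Fn S'F]; exists F => //; exact: subset_trans S'F. Qed.

Lemma nowhere_dense0 : nowhere_dense (@set0 T).
Proof. by rewrite /nowhere_dense closure0 interior0. Qed.

Lemma nowhere_dense_meager S : nowhere_dense S -> meager S.
Proof. by exists (fun=> S) => // x Sx; exists 0%N. Qed.

Lemma meager0 : meager (@set0 T).
Proof. exact/nowhere_dense_meager/nowhere_dense0. Qed.

Lemma meager_bigcup (I : countType) (S : I -> set T) :
  (forall i, meager (S i)) -> meager (\bigcup_i S i).
Proof.
move=> mS; have /choice[F FP] : forall i, exists F : (set T)^nat,
    (forall n, nowhere_dense (F n)) /\ S i `<=` \bigcup_n F n.
  by move=> i; have [F Fn SF] := mS i; exists F.
exists (fun n => if unpickle n is Some (i, k) then F i k else set0).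
  move=> n; case: unpickle => [[i k]|]; last exact: nowhere_dense0.
  exact: (FP i).1.
move=> x [i _ /(FP i).2[k _ Fx]].
by exists (pickle (i, k)) => //; rewrite pickleK.
Qed.

(** For open [W], this says that [S] is of second category at every point
    of [W]. *)
Definition nonmeager_in S W :=
  forall O, open O -> O !=set0 -> O `<=` W -> ~ meager (S `&` O).

Lemma nonmeager_inS S W W' : W' `<=` W -> nonmeager_in S W -> nonmeager_in S W'.
Proof. by move=> W'W SW O oO O0 OW'; apply: SW => //; exact: subset_trans W'W. Qed.

Definition countable_basis (B : nat -> set T) :=
  (forall n, open (B n)) /\
  forall x U, nbhs x U -> exists2 n, B n x & B n `<=` U.

(** The basic open sets in which [S] is meager have a union [G] in which [S] is
    still meager, because the basis is countable; the rest of [S] is therefore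
    dense in some open set, which cannot meet [G]. *)
Lemma nonmeager_localized (B : nat -> set T) S : countable_basis B ->
  ~ meager S -> exists W, [/\ open W, W !=set0 & nonmeager_in S W].
Proof.
move=> [oB nB] nmS; apply: contrapT => noW; apply: nmS.
pose C n := if `[< meager (S `&` B n) >] then B n else set0.
pose G := \bigcup_n C n.
have mSG : meager (S `&` G).
  rewrite setI_bigcupr; apply: meager_bigcup => n; rewrite /C.
  by case: asboolP => // _; rewrite setI0; exact: meager0.
have nSG : nowhere_dense (S `\` G).
  rewrite /nowhere_dense -subset0 => x xW; apply: noW.
  exists (interior (closure (S `\` G))); split; first exact: open_interior.
    by exists x.
  move=> O oO [y Oy] OW mSO; have [n Bny BnO] := nB _ _ (open_nbhs_nbhs (conj oO Oy)).
  have CB : C n = B n.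
    rewrite /C; case: asboolP => //; case.
    by apply: meagerS mSO => z [Sz /BnO].
  have [z [[Sz nGz] Bnz]] : (S `\` G) `&` B n !=set0.
    apply: (interior_subset (OW _ Oy)); exact: open_nbhs_nbhs (conj (oB n) Bny).
  by apply: nGz; exists n => //; rewrite CB.
have -> : S = \bigcup_(b : bool) (if b then S `&` G else S `\` G).
  apply/seteqP; split=> [x Sx|x [[] _ []//]].
  by have [Gx|nGx] := pselect (G x); [exists true|exists false].
by apply: meager_bigcup => -[] //; exact: nowhere_dense_meager.
Qed.

End Meager.

(** * Metrics inducing a topology *)

Section Metric.
Variables (R : realType) (T : topologicalType) (d : T -> T -> R).
Hypotheses (dm : is_metric d) (dT : metrizes d).

Lemma distxx x : d x x = 0. Proof. by have [] := dm. Qed.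
Lemma distC x y : d x y = d y x. Proof. by have [] := dm. Qed.
Lemma dist_triangle y x z : d x z <= d x y + d y z. Proof. by have [] := dm. Qed.
Lemma dist_eq0 x y : d x y = 0 -> x = y.
Proof. by have [_ h _ _] := dm; exact: h. Qed.

Lemma dist_ge0 x y : 0 <= d x y.
Proof.
have := dist_triangle y x x; rewrite distxx (distC y x) -mulr2n.
by rewrite pmulrn_lge0.
Qed.

Lemma nbhs_dist x e : 0 < e -> nbhs x [set y | d x y < e].
Proof. by move=> e0; rewrite dT; exists e. Qed.

Lemma nbhs_distP x U : nbhs x U ->
  exists2 e, 0 < e & forall y, d x y < e -> U y.
Proof. by rewrite dT => -[e /= e0 eU]; exists e. Qed.

Lemma open_dist_ball x e : open [set y | d x y < e].
Proof.
rewrite openE => y /= dxy; have e0 : 0 < e - d x y by rewrite subr_gt0.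
apply: filterS (nbhs_dist y e0) => z /=; rewrite ltrBrDl.
exact/le_lt_trans/dist_triangle.
Qed.

Lemma closed_dist_ball x e : closed [set y | d x y <= e].
Proof.
rewrite -openC openE => y /= /negP; rewrite -ltNge => dxy.
have e0 : 0 < d x y - e by rewrite subr_gt0.
apply: filterS (nbhs_dist y e0) => z /=; rewrite ltrBrDr => h.
apply/negP; rewrite -ltNge; rewrite -ltrBrDl in h; apply: lt_le_trans h _.
by rewrite lerBlDr (distC y z); exact: dist_triangle.
Qed.

Lemma metric_hausdorff : hausdorff_space T.
Proof.
move=> x y xy; apply: contrapT => neq; have d0 : 0 < d x y / 2.
  rewrite divr_gt0// lt_neqAle dist_ge0 andbT eq_sym.
  by apply/eqP => /dist_eq0.
have [z [/= xz yz]] := xy _ _ (nbhs_dist x d0) (nbhs_dist y d0).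
have := dist_triangle z x y; rewrite leNgt => /negP; apply.
by rewrite (splitr (d x y)) (distC z y) ltrD.
Qed.

Lemma metric_countable_basis (a : nat -> T) : dense (range a) ->
  exists B, countable_basis (T := T) B.
Proof.
move=> aD; pose b (p : nat * nat) := [set y | d (a p.1) y < p.2.+1%:R^-1].
exists (fun n => if unpickle n is Some p then b p else set0); split.
  by move=> n; case: unpickle => [p|]; [exact: open_dist_ball|exact: open0].
move=> x U /nbhs_distP[e e0 eU].
have [k ke] : exists k : nat, k.+1%:R^-1 < e / 2.
  have [k _ /(_ k (leqnn k))] := near_infty_natSinv_lt (PosNum (divr_gt0 e0 (ltr0Sn R 1))).
  by exists k.
have [y [/= xy [i _ ai]]] : [set y | d x y < k.+1%:R^-1] `&` range a !=set0.
  apply: aD; [by exists x; rewrite /= distxx|exact: open_dist_ball].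
exists (pickle (i, k)); rewrite pickleK /b /= ai.
  by rewrite distC.
move=> z yz; apply: eU; rewrite (splitr e).
apply: le_lt_trans (dist_triangle y x z) _.
by rewrite ltrD// (lt_trans _ ke).
Qed.

End Metric.

(** * Souslin schemes *)

Definition branch (I : Type) (u : nat -> seq I) :=
  u 0%N = [::] /\ forall n, exists i, u n.+1 = i :: u n.

Lemma branch_map (I J : Type) (h : I -> J) u : branch u -> branch (map h \o u).
Proof.
move=> [u0 uS]; split=> [|n] /=; first by rewrite u0.
by have [i ->] := uS n; exists (h i).
Qed.

Lemma size_branch (I : Type) (u : nat -> seq I) n : branch u -> size (u n) = n.
Proof.
by move=> [u0 uS]; elim: n => [|n IHn]; [rewrite u0|have [i -> /=] := uS n; rewrite IHn].
Qed.

Lemma branch_le (I T : Type) (F : seq I -> set T) u m n :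
  (forall s i, F (i :: s) `<=` F s) -> branch u -> (m <= n)%N ->
  F (u n) `<=` F (u m).
Proof.
move=> Fmono [_ uS]; elim: n => [|n IHn]; first by rewrite leqn0 => /eqP ->.
rewrite leq_eqVlt => /predU1P[-> //|/IHn]; apply: subset_trans.
by have [i ->] := uS n; exact: Fmono.
Qed.

(** A Souslin scheme for [S], in a form that is stable under products, images
    and intersections. Sequences grow at their head, so [i :: s] extends the
    finite branch [s]. *)
Definition scheme_for (T : topologicalType) (I : Type) (F : seq I -> set T)
    (S : set T) :=
  [/\ S `<=` F [::],
      forall s, F s `<=` \bigcup_i F (i :: s),
      forall s i, F (i :: s) `<=` F s &
      forall u, branch u -> (forall n, F (u n) !=set0) ->
        exists2 x, S x & forall U, nbhs x U -> exists n, F (u n) `<=` U].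

Definition souslin (T : topologicalType) (S : set T) :=
  exists (I : countType) (F : seq I -> set T), scheme_for F S.

Lemma souslin0 (T : topologicalType) : souslin (@set0 T).
Proof.
exists nat, (fun=> set0); split=> [//|s x []|s i x []|u _ F0].
by have [x []] := F0 0%N.
Qed.

Lemma separable_dense_sequence (T : topologicalType) : Defs.separable T ->
  (forall x : T, False) \/ exists a : nat -> T, dense (range a).
Proof.
move=> [D /pfcard_geP[D0|[a]] dD].
  left=> x; have [] := dD setT; [by exists x|exact: openT|].
  by move=> y; rewrite D0 => -[].
right; exists a; suff -> : range a = D by [].
exact: image_eq.
Qed.

Lemma small_natSinv (R : realType) (e : R) : 0 < e -> exists k : nat, k.+1%:R^-1 < e.
Proof.
move=> e0; have [k _ /(_ k (leqnn k))] := near_infty_natSinv_lt (PosNum e0).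
by exists k.
Qed.

Section Continuous_image.
Variables (R : realType) (P T : topologicalType) (d : P -> P -> R) (f : P -> T).
Hypotheses (dm : is_metric d) (dP : metrizes d).

Let Fixpoint G (a : nat -> P) (s : seq nat) : set P :=
  if s is i :: s' then G a s' `&` [set p | d (a i) p < (size s').+1%:R^-1]
  else setT.

(** The images of the intersections of balls of radii 1, 1/2, 1/3, ... centred
    in a dense sequence form a scheme: along a branch the balls determine a
    Cauchy sequence, hence a point of the domain. *)
Lemma souslin_range (a : nat -> P) :
  (forall u : nat -> P, cauchy_seq d u -> exists l : P, u @ \oo --> l) ->
  dense (range a) -> continuous f -> souslin (range f).
Proof.
move=> cP aD cf; exists nat, (fun s => f @` G a s); split => //.
- move=> s _ [p Gp <-].
  have [q [/= pq [i _ aiq]]] :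
      [set q | d p q < (size s).+1%:R^-1] `&` range a !=set0.
    apply: aD; last exact: open_dist_ball.
    by exists p; rewrite /= (distxx dm) invr_gt0.
  by exists i => //; exists p => //; split => //=; rewrite (distC dm) aiq.
- by move=> s i _ [p [Gp _] <-]; exists p.
move=> u bu Fu.
have Gmono m n : (m <= n)%N -> G a (u n) `<=` G a (u m).
  by apply: branch_le => // s i p [].
have /choice[p Gp] : forall n, exists p, G a (u n) p.
  by move=> n; have [_ [p Gp _]] := Fu n; exists p.
have small e : 0 < e -> exists n, forall q r, G a (u n) q -> G a (u n) r -> d q r < e.
  move=> e0; have [k ke] := small_natSinv (divr_gt0 e0 (ltr0Sn R 1)).
  exists k.+1 => q r; have [i ->] := bu.2 k => /=.
  rewrite size_branch// => -[_ iq] [_ ir]; rewrite (splitr e).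
  apply: le_lt_trans (dist_triangle dm (a i) q r) _; rewrite (distC dm q).
  by rewrite ltrD// (lt_trans _ ke).
have [l pl] : exists l : P, p @ \oo --> l.
  apply: cP => e /small[N HN]; exists N => m n Nm Nn.
  by apply: HN; [exact: Gmono Nm _ _|exact: Gmono Nn _ _].
exists (f l) => // U /cf /(nbhs_distP dP)[e e0 eU].
have e20 := divr_gt0 e0 (ltr0Sn R 1).
have [n Hn] := small _ e20.
have [N _ HN] : \forall m \near \oo, d l (p m) < e / 2.
  exact: (pl _ (nbhs_dist dP l e20)).
exists n => _ [q Gq <-]; apply: eU; rewrite (splitr e).
apply: le_lt_trans (dist_triangle dm (p (maxn N n)) l q) _.
rewrite ltrD//; first by apply: HN => /=; exact: leq_maxl.
by apply: Hn => //; apply: Gmono (Gp _); exact: leq_maxr.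
Qed.

End Continuous_image.

Lemma analytic_souslin (R : realType) (T : topologicalType) (A : set T) :
  analytic R (set_type A) -> souslin A.
Proof.
move=> [P [[sP [d [dm dP cP]]] [f cf fA]]].
have -> : A = range (set_val \o f).
  apply/seteqP; split=> [x Ax|_ [p _ <-]]; last exact: set_valP.
  have : [set: A] (SigSub (mem_set Ax)) by [].
  by rewrite -fA => -[p _ fp]; exists p => //=; rewrite fp.
have [P0|[a aD]] := separable_dense_sequence sP.
  suff -> : range (set_val \o f) = set0 by exact: souslin0.
  by apply/seteqP; split=> // x [p]; have := P0 p.
apply: (souslin_range dm dP cP aD) => p.
by apply: continuous_comp; [exact: cf|exact: initial_continuous].
Qed.

Section Souslin_operations.
Implicit Types T : topologicalType.

Lemma souslin_image T T' (h : T -> T') (S : set T) :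
  continuous h -> souslin S -> souslin (h @` S).
Proof.
move=> ch [I [F [SF Fcov Fmono Flim]]]; exists I, (fun s => h @` F s); split.
- by move=> _ [x Sx <-]; exists x => //; exact: SF.
- by move=> s _ [x /Fcov[i _ Fx] <-]; exists i => //; exists x.
- by move=> s i _ [x /Fmono Fx <-]; exists x.
move=> u bu Fu; have [||x Sx xlim] := Flim u => //.
  by move=> n; have [_ [x Fx _]] := Fu n; exists x.
exists (h x); first by exists x.
move=> U /ch /xlim[n FU]; exists n => _ [y Fy <-]; exact: FU.
Qed.

Lemma souslinX T1 T2 (S1 : set T1) (S2 : set T2) :
  souslin S1 -> souslin S2 -> souslin (S1 `*` S2).
Proof.
move=> [I1 [F1 [SF1 cov1 mono1 lim1]]] [I2 [F2 [SF2 cov2 mono2 lim2]]].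
exists (I1 * I2)%type, (fun s => F1 (map fst s) `*` F2 (map snd s)); split.
- by move=> [x y] [/= /SF1 ? /SF2].
- by move=> s [x y] [/= /cov1[i _ ?] /cov2[j _ ?]]; exists (i, j).
- by move=> s i [x y] [/= /mono1 ? /mono2].
move=> u bu Fu; have b1 := branch_map fst bu; have b2 := branch_map snd bu.
have [|x Sx xlim] := lim1 _ b1; first by move=> n; have [[x y] []] := Fu n; exists x.
have [|y Sy ylim] := lim2 _ b2; first by move=> n; have [[? z] []] := Fu n; exists z.
exists (x, y) => // U [[V W] /= [xV yW] VWU].
have [[m FV] [n FW]] := (xlim _ xV, ylim _ yW).
exists (maxn m n) => -[v w] [/= Fv Fw]; apply: VWU; split => /=.
  by apply/FV/(branch_le mono1 b1 (leq_maxl m n)).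
by apply/FW/(branch_le mono2 b2 (leq_maxr m n)).
Qed.

Lemma souslinI_closed T (S C : set T) :
  closed C -> souslin S -> souslin (S `&` C).
Proof.
move=> cC [I [F [SF Fcov Fmono Flim]]]; exists I, (fun s => F s `&` C); split.
- by move=> x [/SF ? ?].
- by move=> s x [/Fcov[i _ Fx] Cx]; exists i.
- by move=> s i x [/Fmono Fx ?].
move=> u bu Fu; have [||x Sx xlim] := Flim u => //.
  by move=> n; have [x [Fx _]] := Fu n; exists x.
exists x; last by move=> U /xlim[n FU]; exists n => y [/FU].
split=> //; apply: cC => U /xlim[n FU].
by have [y [/FU Uy Cy]] := Fu n; exists y.
Qed.

Lemma hausdorff_disjoint_nbhs T (x y : T) : hausdorff_space T -> x <> y ->
  exists U V : set T, [/\ nbhs x U, nbhs y V & forall z, U z -> V z -> False].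
Proof.
move=> hT xy; apply: contrapT => noUV; apply: xy; apply: hT => U V xU yV.
apply: contrapT => UV0; apply: noUV; exists U, V; split => // z Uz Vz.
by apply: UV0; exists z.
Qed.

Lemma souslinI T (S1 S2 : set T) : hausdorff_space T ->
  souslin S1 -> souslin S2 -> souslin (S1 `&` S2).
Proof.
move=> hT [I1 [F1 [SF1 cov1 mono1 lim1]]] [I2 [F2 [SF2 cov2 mono2 lim2]]].
exists (I1 * I2)%type, (fun s => F1 (map fst s) `&` F2 (map snd s)); split.
- by move=> x [/SF1 ? /SF2].
- by move=> s x [/cov1[i _ ?] /cov2[j _ ?]]; exists (i, j).
- by move=> s i x [/mono1 ? /mono2].
move=> u bu Fu; have b1 := branch_map fst bu; have b2 := branch_map snd bu.
have [|x Sx xlim] := lim1 _ b1; first by move=> n; have [x []] := Fu n; exists x.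
have [|y Sy ylim] := lim2 _ b2; first by move=> n; have [z []] := Fu n; exists z.
have xy : x = y.
  apply: contrapT => /(hausdorff_disjoint_nbhs hT)[U [V [/xlim[m FU] /ylim[n FV] UV0]]].
  have [z [Fz1 Fz2]] := Fu (maxn m n); apply: (UV0 z).
    by apply/FU/(branch_le mono1 b1 (leq_maxl m n)).
  by apply/FV/(branch_le mono2 b2 (leq_maxr m n)).
exists x; first by split=> //; rewrite xy.
by move=> U /xlim[n FU]; exists n => z [/FU].
Qed.

End Souslin_operations.

(** * Non-meager Souslin sets *)

Section Overlap.
Variables (T : topologicalType) (B : nat -> set T).
Hypotheses (basisB : countable_basis B) (hT : hausdorff_space T).

(** One of the countably many successors of a node is not meager in [W]; it is
    of second category throughout some smaller open set. *)
Lemma scheme_refine (I : countType) (F : seq I -> set T) s W :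
  F s `<=` \bigcup_i F (i :: s) -> open W -> W !=set0 -> nonmeager_in (F s) W ->
  exists i W', [/\ open W', W' !=set0, W' `<=` W & nonmeager_in (F (i :: s)) W'].
Proof.
move=> Fcov oW W0 FW; apply: contrapT => noi; apply: (FW W) => //.
apply: (@meagerS _ _ (\bigcup_i (F (i :: s) `&` W))).
  by rewrite -setI_bigcupl; exact: setSI.
apply: meager_bigcup => i; apply: contrapT => nm; apply: noi.
have [V [oV V0 nV]] := nonmeager_localized basisB nm.
exists i, (V `&` W); split; [exact: openI| |exact: subIsetr|].
  apply/set0P/eqP => VW0; apply: (nV V) => //.
  by rewrite -setIA (setIC W) VW0 setI0; exact: meager0.
move=> O oO O0 OVW mFO; apply: (nV O) => //; first by move=> x /OVW[].
by apply: meagerS mFO; apply: setSI; exact: subIsetl.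
Qed.

(** Descending along both schemes at once, and keeping both sets
    of second category in a common open set, one obtains two branches
    whose limit points cannot be separated. *)
Lemma souslin_overlap (S1 S2 W : set T) : souslin S1 -> souslin S2 ->
  open W -> W !=set0 -> nonmeager_in S1 W -> nonmeager_in S2 W ->
  S1 `&` S2 !=set0.
Proof.
move=> [I1 [F1 [SF1 cov1 mono1 lim1]]] [I2 [F2 [SF2 cov2 mono2 lim2]]].
move=> oW W0 nW1 nW2.
pose good (p : seq I1 * seq I2 * set T) :=
  [/\ open p.2, p.2 !=set0, nonmeager_in (F1 p.1.1) p.2 & nonmeager_in (F2 p.1.2) p.2].
pose step (p q : {p | good p}) := exists i j,
  (sval q).1.1 = i :: (sval p).1.1 /\ (sval q).1.2 = j :: (sval p).1.2.
have nonmeager_inW S S' V : S `<=` S' -> nonmeager_in S V -> nonmeager_in S' V.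
  move=> SS' nS O oO O0 OV mO; apply: (nS O) => //.
  by apply: meagerS mO; exact: setSI.
have g0 : good ([::], [::], W).
  by split => //=; [apply: nonmeager_inW nW1|apply: nonmeager_inW nW2].
have stepP p : {q | step p q}.
  apply: cid; case: p => -[[s t] V] [/= oV V0 nV1 nV2].
  have [i [V' [oV' V'0 V'V nV'1]]] := scheme_refine (@cov1 s) oV V0 nV1.
  have nV'2 := nonmeager_inS V'V nV2.
  have [j [V'' [oV'' V''0 V''V' nV''2]]] := scheme_refine (@cov2 t) oV' V'0 nV'2.
  have gq : good (i :: s, j :: t, V'') by split => //=; exact: nonmeager_inS nV'1.
  by exists (exist _ _ gq), i, j.
have [p [p0 pS]] := dependent_choice stepP (exist _ _ g0).
have b1 : branch (fun n => (sval (p n)).1.1).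
  by split=> [|n]; [rewrite p0|have [i [j [? ?]]] := pS n; exists i].
have b2 : branch (fun n => (sval (p n)).1.2).
  by split=> [|n]; [rewrite p0|have [i [j [? ?]]] := pS n; exists j].
have meet (F : set T) n O : open O -> O `&` (sval (p n)).2 !=set0 ->
    nonmeager_in F (sval (p n)).2 -> F `&` O !=set0.
  move=> oO O0 nF; apply/set0P/eqP => FO0.
  have [oV _ _ _] := svalP (p n).
  apply: (nF (O `&` (sval (p n)).2)) => //; first exact: openI.
  by rewrite setIA FO0 set0I; exact: meager0.
have V0 n : setT `&` (sval (p n)).2 !=set0.
  by rewrite setTI; have [] := svalP (p n).
have [|x Sx xlim] := lim1 _ b1.
  move=> n; have [_ _ nV _] := svalP (p n).
  by have [x []] := meet _ _ _ openT (V0 n) nV; exists x.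
have [|y Sy ylim] := lim2 _ b2.
  move=> n; have [_ _ _ nV] := svalP (p n).
  by have [z []] := meet _ _ _ openT (V0 n) nV; exists z.
suff xy : x = y by exists x; split=> //; rewrite xy.
apply: contrapT => /(hausdorff_disjoint_nbhs hT)[U [V [xU /ylim[n FV] UV0]]].
have /xlim[m FU] : nbhs x U^° by exact: nbhs_interior.
pose N := maxn m n; have [oN _ nN1 nN2] := svalP (p N).
have [z [Fz Vz]] : F1 (sval (p N)).1.1 `&` (sval (p N)).2 !=set0.
  by apply: meet nN1 => //; rewrite setIid -[X in X !=set0]setTI.
have Uz : U^° z by apply/FU/(branch_le mono1 b1 (leq_maxl m n)).
have [w [Fw Uw]] : F2 (sval (p N)).1.2 `&` U^° !=set0.
  by apply: meet nN2; [exact: open_interior|exists z].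
apply: (UV0 w); first exact: interior_subset.
by apply/FV/(branch_le mono2 b2 (leq_maxr m n)).
Qed.

End Overlap.

(** * Difference sets of convex sets *)

Lemma meager_preimage (T T' : topologicalType) (h : T -> T') (g : T' -> T)
    (S : set T') : continuous h -> continuous g -> cancel h g -> cancel g h ->
  meager S -> meager (h @^-1` S).
Proof.
move=> ch cg hK gK [F Fn SF]; exists (fun n => h @^-1` F n); last first.
  by move=> x /SF[n _ Fx]; exists n.
move=> n; rewrite /nowhere_dense -subset0 => x xF.
suff : interior (closure (F n)) (h x) by rewrite (Fn n).
have xF' : nbhs (h x) (g @^-1` closure (h @^-1` F n)) by apply: cg; rewrite hK.
apply: filterS xF'; move=> y /= ycl U yU; have hU : nbhs (g y) (h @^-1` U) by apply: ch; rewrite gK.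
by have [z [Fz Uz]] := ycl _ hU; exists (h z).
Qed.

Section Vector_space.
Variables (R : realType) (X : topologicalLmodType R).
Implicit Types (A S U : set X) (x y v : X).

Lemma cvg_addr (T : Type) (F : set_system T) (f g : T -> X) x y : Filter F ->
  f @ F --> x -> g @ F --> y -> (fun t => f t + g t) @ F --> x + y.
Proof.
move=> FF; exact: (@continuous2_cvg _ X X X F _ f g +%R _ _ (@add_continuous X (x, y))).
Qed.

Lemma cvg_subr (T : Type) (F : set_system T) (f g : T -> X) x y : Filter F ->
  f @ F --> x -> g @ F --> y -> (fun t => f t - g t) @ F --> x - y.
Proof.
move=> FF; exact: (@continuous2_cvg _ X X X F _ f g (fun a b => a - b) _ _
  (@sub_continuous X (x, y))).
Qed.

Lemma cvg_scaler (T : Type) (F : set_system T) (k : T -> R)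
    (f : T -> X) (a : R) x :
  Filter F -> k @ F --> (a : R^o) -> f @ F --> x -> (fun t => k t *: f t) @ F --> a *: x.
Proof.
move=> FF; exact: (@continuous2_cvg _ R^o X X F _ k f (fun a x => a *: x) _ _
  (@scale_continuous R X (a, x))).
Qed.

Lemma addr_continuous v : continuous (+%R^~ v : X -> X).
Proof. by move=> x; exact: (@cvg_addr X (nbhs x) id (fun=> v) x v _ cvg_id (cvg_cst v)). Qed.

Lemma scaler_continuous (k : R) : continuous ( *:%R k : X -> X).
Proof.
by move=> x; exact: (@cvg_scaler X (nbhs x) (fun=> k) id k x _ (cvg_cst (k : R^o)) cvg_id).
Qed.

Lemma nbhs0_shift x U : nbhs x U -> nbhs 0 [set v | U (x + v)].
Proof.
move=> xU; apply: (@cvg_addr X (nbhs 0) (fun=> x) id x 0 _ (cvg_cst x) cvg_id).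
by rewrite addr0.
Qed.

Lemma nbhs0_scale (k : R) U : nbhs 0 U -> nbhs 0 [set v | U (k *: v)].
Proof.
by move=> U0; apply: (@scaler_continuous k 0 U) => /=; rewrite scaler0.
Qed.

Lemma diff_setS A A' : A `<=` A' -> diff_set A A `<=` diff_set A' A'.
Proof. by move=> AA' _ [a Aa [b Ab <-]]; exists a; [exact: AA'|exists b; [exact: AA'|]]. Qed.

Lemma souslin_diff A : souslin A -> souslin (diff_set A A).
Proof.
move=> sA; suff -> : diff_set A A = (fun p : X * X => p.1 - p.2) @` (A `*` A).
  by apply: souslin_image; [exact: sub_continuous|exact: souslinX].
apply/seteqP; split=> [_ [a Aa [b Ab <-]]|_ [[a b] [/= Aa Ab] <-]].
  by exists (a, b).
by exists a => //; exists b.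
Qed.

(** Pettis' theorem: a translate of [S] by a small vector overlaps [S]. *)
Lemma souslin_diff_nbhs (B : nat -> set X) S : countable_basis B ->
  hausdorff_space X -> souslin S -> ~ meager S -> nbhs 0 (diff_set S S).
Proof.
move=> bB hX sS /(nonmeager_localized bB)[W [oW [w Ww] nW]].
apply: filterS (nbhs0_shift (open_nbhs_nbhs (conj oW Ww))) => x /= Wwx.
pose W' := W `&` (fun y => y - x) @^-1` W.
have oW' : open W'.
  by apply: openI => //; apply: open_comp => // y _; exact: addr_continuous.
have [_ [/[swap] -[s Ss' <-] Ss]] : S `&` translate S x !=set0.
  apply: (souslin_overlap bB hX _ _ oW') => //.
  - by apply: souslin_image => //; exact: addr_continuous.
  - by exists (w + x); split=> //=; rewrite addrK.
  - by apply: nonmeager_inS nW; exact: subIsetl.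
  move=> O oO [z Oz] OW' mSO; apply: (nW ((fun y => y + x) @^-1` O)).
  - by apply: open_comp => // y _; exact: addr_continuous.
  - by exists (z - x); rewrite /= subrK.
  - by move=> y /OW'[_ /=]; rewrite addrK.
  apply: meagerS (@meager_preimage _ _ (+%R^~ x) (+%R^~ (- x)) _ _ _ _ _ mSO).
  - by move=> y [Sy Oy]; split=> //; exists y.
  - exact: addr_continuous.
  - exact: addr_continuous.
  - exact: addrK.
  - exact: subrK.
by exists (s + x) => //; exists s => //; rewrite addrAC subrr add0r.
Qed.

Section Convex.
Variable A : set X.
Hypothesis convexA : convex_set A.

Lemma convexE (t : R) x y : 0 <= t -> t <= 1 -> A x -> A y ->
  A (t *: x + (1 - t) *: y).
Proof.
move=> t0 t1 Ax Ay; have it : Itv.spec (Itv.num_sem (R:=R)) (Itv.Real `[0%Z, 1%Z]) t.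
  by rewrite /Itv.num_sem /= in_itv /= t0 t1 ger0_real.
have /set_mem := convexA (Itv.mk it) (mem_set Ax) (mem_set Ay).
by [].
Qed.

Lemma convex_mid x y : A x -> A y -> A (2^-1 *: (x + y)).
Proof.
move=> Ax Ay; have h : 1 - 2^-1 = 2^-1 :> R by rewrite [X in X - _](splitr 1) mul1r addrK.
have := @convexE 2^-1 x y _ _ Ax Ay; rewrite h scalerDr; apply.
  by rewrite invr_ge0.
by rewrite invf_le1 ?ler1n.
Qed.

Lemma convex_average n (b : 'I_n.+1 -> X) : (forall i, A (b i)) ->
  A (n.+1%:R^-1 *: \sum_i b i).
Proof.
elim: n b => [|n IHn] b Ab; first by rewrite big_ord1 invr1 scale1r.
rewrite big_ord_recl /=.
have n0 : n.+1%:R != 0 :> R by rewrite pnatr_eq0.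
have n1 : n.+2%:R != 0 :> R by rewrite pnatr_eq0.
have := @convexE n.+2%:R^-1 _ _ _ _ (Ab ord0) (IHn _ (fun i => Ab (lift ord0 i))).
rewrite scalerA scalerDr.
have -> : (1 - n.+2%:R^-1) / n.+1%:R = n.+2%:R^-1 :> R.
  apply: (mulIf n0); rewrite divfK//; apply: (mulIf n1).
  by rewrite mulrBl mul1r mulrAC !mulVf// mul1r -[n.+2]addn1 natrD addrK.
apply; first by rewrite invr_ge0.
by rewrite invf_le1 ?ler1n.
Qed.

(** If [n u_i = a_i - b_i] for all [i < n], then moving each [u_i] by the
    average [x] of the [b_j] gives the average of the [b_j] in which [b_i] is
    replaced by [a_i]. *)
Lemma common_translate n : nbhs 0 (diff_set A A) ->
  exists2 U, nbhs 0 U & forall u : 'I_n -> X, (forall i, U (u i)) ->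
    exists x, forall i, A (u i + x).
Proof.
case: n => [|n] AA; first by exists setT => [|u _]; [exact: filterT|exists 0 => -[]].
exists [set v | diff_set A A (n.+1%:R *: v)]; first exact: nbhs0_scale.
move=> u Uu; have /choice[p pP] : forall i, exists p : X * X,
    [/\ A p.1, A p.2 & p.1 - p.2 = n.+1%:R *: u i].
  by move=> i; have [a Aa [b Ab ab]] := Uu i; exists (a, b).
exists (n.+1%:R^-1 *: \sum_j (p j).2) => i.
have n0 : n.+1%:R != 0 :> R by rewrite pnatr_eq0.
suff -> : u i + n.+1%:R^-1 *: \sum_j (p j).2 =
    n.+1%:R^-1 *: \sum_j (if j == i then (p j).1 else (p j).2).
  by apply: convex_average => j; case: ifP => _; have [] := pP j.
rewrite (bigD1 i)//= [in RHS](bigD1 i)//= eqxx.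
rewrite [in RHS](eq_bigr (fun j => (p j).2)); last by move=> j /negPf ->.
have [_ _ pi] := pP i; rewrite -[in RHS](subrK (p i).2 (p i).1) pi -addrA.
by rewrite [in RHS]scalerDr scalerA mulVf// scale1r.
Qed.

Lemma diff_diff_set : diff_set (diff_set A A) (diff_set A A) `<=`
  [set v | diff_set A A (2^-1 *: v)].
Proof.
move=> _ [_ [a Aa [b Ab <-]] [_ [c Ac [e Ae <-]] <-]] /=.
exists (2^-1 *: (a + e)); first exact: convex_mid.
exists (2^-1 *: (b + c)); first exact: convex_mid.
by rewrite -scalerBr opprB opprD addrACA (addrC e).
Qed.

(** By [diff_diff_set], the neighbourhood of zero given by Pettis' theorem for
    [A - A] is contained in [2 (A - A)]. *)
Lemma diff_set_meager (B : nat -> set X) : countable_basis B -> hausdorff_space X ->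
  souslin A -> ~ nbhs 0 (diff_set A A) -> meager (diff_set A A).
Proof.
move=> bB hX sA nA; apply: contrapT => nm; apply: nA.
have := souslin_diff_nbhs bB hX (souslin_diff sA) nm.
move=> /(filterS diff_diff_set)/(nbhs0_scale 2); apply: filterS => v /=.
by rewrite scalerA mulVf ?pnatr_eq0// scale1r.
Qed.

End Convex.
End Vector_space.

(** * Cylinders of the Cantor cube *)

Definition cylinder (s : cantor_space) (n : nat) : set cantor_space :=
  [set t | forall i, (i < n)%N -> t i = s i].

Lemma cylinder_eq s t n : cylinder s n t -> cylinder t n = cylinder s n.
Proof.
by move=> st; apply/seteqP; split=> u h i ni; rewrite h// st.
Qed.

Lemma cylinder_le s m n : (m <= n)%N -> cylinder s n `<=` cylinder s m.
Proof. by move=> mn t st i im; apply: st; exact: leq_trans mn. Qed.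

Lemma nbhs_coordinate (s : cantor_space) i : nbhs s [set t : cantor_space | t i = s i].
Proof.
exact: (@proj_continuous nat (fun=> bool) i s _ (discrete_set1 (s i))).
Qed.

Lemma nbhs_cylinder s n : nbhs s (cylinder s n).
Proof.
have := @filter_forall _ 'I_n (fun i => [set t : cantor_space | t i = s i]) (nbhs s)
  (nbhs_filter s) (fun i => nbhs_coordinate s i).
by move=> H; apply: filterS H => t st i ni; exact: (st (Ordinal ni)).
Qed.

Lemma cylinder_nbhs (s : cantor_space) U : nbhs s U -> exists n, cylinder s n `<=` U.
Proof.
pose F := filter_from setT (cylinder s).
have FF : Filter F.
  apply: filter_from_filter; first by exists 0%N.
  move=> m n _ _; exists (maxn m n) => // t st.
  by split; apply: cylinder_le st; rewrite ?leq_maxl ?leq_maxr.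
have Fs : {ptws, F --> (s : nat -> bool)}.
  apply/pointwise_cvgP => i A /nbhs_singleton As.
  by exists i.+1 => // t st /=; rewrite st.
by move=> /Fs[n _ sU]; exists n.
Qed.

Lemma compact_cylinder s n : compact (cylinder s n).
Proof.
apply: subclosed_compact cantor_space_compact _ => //.
move=> t tcl; have [u [su tu]] := tcl _ (nbhs_cylinder t n).
by rewrite -(cylinder_eq su) (cylinder_eq tu).
Qed.

(** A map that depends on the first [n] coordinates only has finitely many
    values; truncating and padding with zeros picks a point in each cylinder. *)
Definition truncation (s : cantor_space) n : {ffun 'I_n -> bool} := [ffun i : 'I_n => s i].

Definition pad n (c : {ffun 'I_n -> bool}) : cantor_space :=
  fun i => if insub i is Some j then c j else false.

Lemma cylinder_pad s n : cylinder s n (pad (truncation s n)).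
Proof. by move=> i ni; rewrite /pad insubT ffunE. Qed.

Lemma eq_truncation s t n : cylinder s n t -> truncation t n = truncation s n.
Proof. by move=> st; apply/ffunP => i; rewrite !ffunE st. Qed.

Lemma locally_constant_continuous (T : topologicalType) (g : cantor_space -> T) n :
  (forall s t, cylinder s n t -> g t = g s) -> continuous g.
Proof.
move=> gn s U /nbhs_singleton Us; apply: filterS (nbhs_cylinder s n) => t st /=.
by rewrite (gn s t).
Qed.

(** * The space of continuous maps on the Cantor cube *)

Section Uniform_convergence.
Variables (R : realType) (T : topologicalType) (d : T -> T -> R).
Hypotheses (dm : is_metric d) (dT : metrizes d).
Local Notation C := (compact_open_C cantor_space T).

Lemma near_natSinv (e : R) : 0 < e -> \forall k \near \oo, (k.+1%:R^-1 : R) < e.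
Proof. by move=> e0; exact: (near_infty_natSinv_lt (PosNum e0)). Qed.

Lemma uniformly_continuous (f : cantor_space -> T) e : continuous f -> 0 < e ->
  exists n, forall s t, cylinder s n t -> d (f s) (f t) < e.
Proof.
move=> cf e0.
have := iffLR (compact_near_coveringP _) cantor_space_compact nat \oo
  (fun n s => forall t, cylinder s n t -> d (f s) (f t) < e) _.
case.
  move=> s _; have e20 := divr_gt0 e0 (ltr0Sn R 1).
  have [n sn] := cylinder_nbhs (cf s _ (nbhs_dist dT (f s) e20)).
  exists (cylinder s n, [set m | (n <= m)%N]).
    by split; [exact: nbhs_cylinder|exists n].
  move=> [s' m] [/= ss' nm] t s't; rewrite (splitr e).
  apply: le_lt_trans (dist_triangle dm (f s) (f s') (f t)) _; rewrite (distC dm (f s')).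
  rewrite ltrD//; first exact: sn.
  by apply: sn; rewrite -(cylinder_eq ss'); exact: cylinder_le s't.
by move=> n _ Hn; exists n => s t; apply: (Hn n) => /=.
Qed.

(** This lemma and the next one say that the compact-open topology is the
    topology of uniform convergence for [d]. *)
Lemma nbhs_uniform_ball (f : C) e : 0 < e ->
  nbhs f [set g : C | forall s, d (f s) (g s) < e].
Proof.
move=> e0; have e20 := divr_gt0 e0 (ltr0Sn R 1).
have := iffLR (compact_near_coveringP _) cantor_space_compact C (nbhs f)
  (fun g s => d (f s) (g s) < e) _.
move=> H; have /filterS : nbhs f [set g : C | [set: cantor_space] `<=`
    (fun s => d (f s) (g s) < e)].
  apply: H => s _.
  have [n sn] := cylinder_nbhs (@cts_fun _ _ f s _ (nbhs_dist dT (f s) e20)).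
  pose B := [set y | d (f s) y < e / 2].
  exists (cylinder s n, [set g : C | g @` cylinder s n `<=` B]).
    split => /=; first exact: nbhs_cylinder.
    apply: open_nbhs_nbhs; split; last by move=> _ [t st <-]; exact: sn.
    exists [set g | g @` cylinder s n `<=` B] => //.
    by apply: compact_open_open; [exact: compact_cylinder|exact: open_dist_ball].
  move=> [s' g] [/= ss' gB]; rewrite (splitr e).
  apply: le_lt_trans (dist_triangle dm (f s) (f s') (g s')) _; rewrite (distC dm (f s')).
  by rewrite ltrD//; [exact: sn|apply: gB; exists s'].
by apply => g Hg s; exact: Hg.
Qed.

Lemma uniform_ball_nbhs (f : C) (O : set C) : nbhs f O ->
  exists2 e, 0 < e & forall g : C, (forall s, d (f s) (g s) < e) -> O g.
Proof.
pose F : set_system {compact-open, cantor_space -> T} := filter_from setT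
  (fun n : nat => [set g | forall s, d (f s) (g s) < n.+1%:R^-1]).
have FF : Filter F.
  apply: filter_from_filter; first by exists 0%N.
  move=> m n _ _; exists (maxn m n) => // g fg.
  split=> s; apply: lt_le_trans (fg s) _;
    by rewrite lef_pV2 ?posrE ?ltr0Sn// ler_nat ltnS ?leq_maxl ?leq_maxr.
have Ff : F --> (f : {compact-open, cantor_space -> T}).
  apply/compact_open_cvgP => K O' cK oO' fKO'.
  have := iffLR (compact_near_coveringP _) cK nat \oo
    (fun n s => forall y, d (f s) y < n.+1%:R^-1 -> O' y) _.
  case.
    move=> s Ks; have Ofs : O' (f s) by apply: fKO'; exists s.
    have [e e0 eO] := nbhs_distP dT (open_nbhs_nbhs (conj oO' Ofs)).
    have e20 := divr_gt0 e0 (ltr0Sn R 1).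
    exists ([set t | d (f s) (f t) < e / 2], [set n | n.+1%:R^-1 < e / 2]).
      split => /=; last exact: near_natSinv.
      exact: (@cts_fun _ _ f s _ (nbhs_dist dT (f s) e20)).
    move=> [t n] [/= st ne] y ty; apply: eO; rewrite (splitr e).
    apply: le_lt_trans (dist_triangle dm (f t) (f s) y) _.
    by rewrite ltrD// (lt_trans ty).
  move=> n _ Hn; exists n => // g fg _ [s Ks <-]; apply: (Hn n) (fg s) => //=.
move=> [_ [[W oW <-] Wf] WO].
have [n _ nW] := Ff _ (open_nbhs_nbhs (conj oW Wf)).
by exists n.+1%:R^-1 => [|g fg]; [rewrite invr_gt0|apply/WO/nW].
Qed.

End Uniform_convergence.

(** * Generic continuous maps *)

Lemma card_le1P (T : Type) (S : set T) :
  S #<= `I_1 <-> forall s t, S s -> S t -> s = t.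
Proof.
split.
  move=> /pcard_leP[f] s t Ss St.
  have f0 r : S r -> f r = 0%N.
    by move=> Sr; have := 'funS_f Sr; rewrite /= ltnS leqn0 => /eqP.
  by apply: ('inj_f (mem_set Ss) (mem_set St)); exact: etrans (f0 _ Ss) (esym (f0 _ St)).
move=> S1; apply: (@card_le_trans _ _ _ [set x | S x]) => //.
have [[s Ss]|S0] := pselect (exists s, S s); last first.
  by rewrite (_ : S = set0) ?card_le0x//; apply/seteqP; split=> // s Ss; apply: S0; exists s.
have [] := card_eq_le [set s] `I_1; rewrite card_set1 => /esym/andP[s1 _].
by apply: card_le_trans s1; apply: subset_card_le => t St; exact: S1.
Qed.

Lemma halving_le_natSinv (R : realType) (r : nat -> R) :
  r 0%N <= 1 -> (forall n, r n.+1 <= r n / 2) -> forall n, r n <= n.+1%:R^-1.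
Proof.
move=> r0 rS; elim=> [|n IHn]; first by rewrite invr1.
apply: le_trans (rS n) _.
apply: (@le_trans _ _ (n.+1%:R^-1 / 2)); first by rewrite ler_pM2r ?invr_gt0.
by rewrite -invfM lef_pV2 ?posrE ?mulr_gt0 ?ltr0Sn// -natrM ler_nat; lia.
Qed.

Section Generic_maps.
Variables (R : realType) (X : topologicalLmodType R) (d : X -> X -> R).
Hypotheses (dm : is_metric d) (dX : metrizes d).
Implicit Types (A F : set X).
Local Notation C := (compact_open_C cantor_space X).

(** A translate of the closed nowhere dense set [F] can be removed from an open
    set, leaving a nonempty open set, for each of the finitely many [w i] in
    turn. *)
Lemma open_avoiding (I : eqType) (w : I -> X) F (O : set X) (l : seq I) :
  closed F -> nowhere_dense F -> open O -> O !=set0 ->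
  exists W, [/\ open W, W !=set0, W `<=` O &
    forall y i, W y -> i \in l -> ~ F (y + w i)].
Proof.
move=> cF nF oO O0; elim: l => [|i l [W [oW W0 WO WF]]].
  by exists O; split.
exists (W `&` [set y | ~ F (y + w i)]); split.
- apply: openI => //.
  by apply: (@open_comp _ _ (+%R^~ (w i)) (~` F)) => [y _|];
    [exact: addr_continuous|rewrite openC].
- apply/set0P/eqP => WF0; have [z Wz] := W0.
  suff : interior (closure F) (z + w i) by rewrite (nF : _ = set0).
  apply: (@filterS _ _ _ ((+%R^~ (- w i)) @^-1` W)).
    move=> y /= Wy; apply: subset_closure; apply: contrapT => nFy.
    suff : set0 (y - w i) by [].
    by rewrite -WF0; split => //=; rewrite subrK.
  apply: addr_continuous => /=; rewrite addrK.
  exact: open_nbhs_nbhs.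
- by move=> y [/WO].
by move=> y j [Wy nFy]; rewrite inE => /predU1P[-> //|/(WF _ _ Wy)].
Qed.

(** Near any map there is one with finitely many values; adding to it a small
    generic constant on the half-cube [s j = b] moves all the finitely many
    differences under consideration out of [F], robustly. *)
Lemma nowhere_dense_differences F j b : closed F -> nowhere_dense F ->
  nowhere_dense [set f : C |
    exists s t, [/\ s j = b, t j = ~~ b & F (f s - f t)]].
Proof.
set N := [set f : C | _] => cF nF; rewrite /nowhere_dense -subset0 => f.
move=> /(uniform_ball_nbhs dm dX)[e e0 fN].
have e20 := divr_gt0 e0 (ltr0Sn R 1).
have [n fn] := uniformly_continuous dm dX (@cts_fun _ _ f) e20.
pose v (c : {ffun 'I_n -> bool}) := f (pad c).
have vf s : d (f s) (v (truncation s n)) < e / 2 by exact/fn/cylinder_pad.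
have V0 : \forall y \near (0 : X), forall c, d (v c) (y + v c) < e / 2.
  apply: filter_forall => c; have := nbhs0_shift (nbhs_dist dX (v c) e20).
  by apply: filterS => y /=; rewrite addrC.
have [W [oW [y Wy] WV WF]] := open_avoiding (fun p : {ffun 'I_n -> bool} * {ffun 'I_n -> bool} =>
  v p.1 - v p.2) (enum {: {ffun 'I_n -> bool} * {ffun 'I_n -> bool}})
  cF nF (open_interior _) (ex_intro _ 0 V0).
have Vy := interior_subset (WV _ Wy).
pose g (s : cantor_space) := if s j == b then y + v (truncation s n) else v (truncation s n).
have cg : continuous g.
  apply: (@locally_constant_continuous _ _ (maxn n j.+1)) => s t st; rewrite /g.
  rewrite (eq_truncation (cylinder_le (leq_maxl _ _) st)).
  by rewrite (st j)// leq_max ltnSn orbT.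
have fg s : d (f s) (g s) < e.
  rewrite /g; case: ifP => _; last by rewrite (lt_trans (vf s))// gtr_pMr// invf_lt1 ?ltr1n.
  rewrite (splitr e); apply: le_lt_trans (dist_triangle dm (v (truncation s n)) _ _) _.
  by rewrite ltrD.
have Ng : closure N (mkcts cg : C) by exact: fN.
have [k Hk] : exists k : nat, forall p : {ffun 'I_n -> bool} * {ffun 'I_n -> bool},
    forall x x', d (y + v p.1) x < k.+1%:R^-1 -> d (v p.2) x' < k.+1%:R^-1 ->
    ~ F (x - x').
  have [k _ Hk] : \forall k \near \oo, forall p : {ffun 'I_n -> bool} * {ffun 'I_n -> bool},
      forall x x', d (y + v p.1) x < k.+1%:R^-1 -> d (v p.2) x' < k.+1%:R^-1 ->
      ~ F (x - x').
    apply: filter_forall => p.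
    have nFp : nbhs (y + v p.1 - v p.2) (~` F).
      apply: open_nbhs_nbhs; split; first by rewrite openC.
      by rewrite /= -addrA; apply: WF => //; rewrite mem_enum.
    have [[U1 U2] [/= /(nbhs_distP dX)[r1 r10 H1] /(nbhs_distP dX)[r2 r20 H2]] U12] :=
      @sub_continuous X (y + v p.1, v p.2) _ nFp.
    near=> k => x x' dx dx'; apply: (U12 (x, x')); split => /=.
      by apply: H1; apply: lt_trans dx _; near: k; exact: near_natSinv.
    by apply: H2; apply: lt_trans dx' _; near: k; exact: near_natSinv.
  by exists k; exact: Hk k (leqnn k).
have [h [[s [t [sb tb Fst]]] gh]] := Ng _ (nbhs_uniform_ball dm dX (mkcts cg : C)
  (e := k.+1%:R^-1) (eq_ind_r _ (ltr0Sn R k) (invr_gt0 _))).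
apply: (Hk (truncation s n, truncation t n) (h s) (h t)) => //=.
  by have := gh s; rewrite /= /mkcts /g sb eqxx.
by have := gh t; rewrite /= /mkcts /g tb; case: (b).
Unshelve. all: by end_near. Qed.

Lemma meager_generically_haar1 A :
  meager (diff_set A A) -> generically_haar1 A.
Proof.
move=> [F nF AF].
pose N (p : nat * nat * bool) := [set f : C | exists s t,
  [/\ s p.1.2 = p.2, t p.1.2 = ~~ p.2 & closure (F p.1.1) (f s - f t)]].
apply: (@meagerS _ _ (\bigcup_p N p)).
  move=> f /= /existsNP[x /(contra_not (card_le1P _).2)].
  move=> /existsNP[s /existsNP[t /not_implyP[[a Aa ax] /not_implyP[[c Ac cx] st]]]].
  have [j sj] : exists j, s j <> t j.
    by apply: contrapT => /forallNP H; apply: st; apply/funext => j; exact: contrapT.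
  have [i _ Fi] : (\bigcup_i F i) (f s - f t).
    apply: AF; exists a => //; exists c => //.
    by rewrite -ax -cx opprD addrACA subrr addr0.
  exists (i, j, s j) => //; exists s, t; split=> //=; last exact: subset_closure.
  by move: sj; case: (s j); case: (t j).
apply: meager_bigcup => p; apply: nowhere_dense_meager.
apply: nowhere_dense_differences; first exact: closed_closure.
rewrite /nowhere_dense -(iffLR (closure_id _) (@closed_closure _ _)).
exact: nF.
Qed.

(** This is Baire's theorem for the uniform metric, which induces the
    compact-open topology and is complete because [d] is. *)
Lemma comeager_nonempty (S : set C) :
  (forall u : nat -> X, cauchy_seq d u -> exists l : X, u @ \oo --> l) ->
  comeager S -> S !=set0.
Proof.
move=> cX [F nF SF].
pose ball (p : C * R) := [set g : C | forall s, d (p.1 s) (g s) <= p.2].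
pose step (p q : {p : nat * (C * R) | 0 < p.2.2}) :=
  [/\ (sval q).1 = (sval p).1.+1, (sval q).2.2 <= (sval p).2.2 / 2,
      ball (sval q).2 `<=` ball (sval p).2 &
      ball (sval q).2 `<=` ~` F (sval p).1].
have stepP p : {q | step p q}.
  apply: cid; case: p => -[n [f e]] /= e0; have e20 := divr_gt0 e0 (ltr0Sn R 1).
  have [g [fg Fg]] : exists g : C, (forall s, d (f s) (g s) < e / 2) /\ ~ closure (F n) g.
    apply: contrapT => noG; suff : interior (closure (F n)) f by rewrite (nF n).
    apply: filterS (nbhs_uniform_ball dm dX f e20) => g fg.
    by apply: contrapT => Fg; apply: noG; exists g.
  have [r r0 gr] : exists2 r, 0 < r & forall h : C, (forall s, d (g s) (h s) < r) -> ~ F n h.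
    have [r r0 gr] := @uniform_ball_nbhs _ _ _ dm dX g (~` closure (F n))
      (open_nbhs_nbhs (conj (closed_openC (@closed_closure _ _)) Fg)).
    by exists r => // h /gr; apply: contra_not; exact: subset_closure.
  pose r' := Num.min (r / 2) (e / 2).
  have r'0 : 0 < r' by rewrite lt_min e20 divr_gt0.
  have r'r : r' < r.
    by rewrite gt_min gtr_pMr// invf_lt1 ?ltr1n.
  have r'e : r' <= e / 2 by rewrite ge_min lexx orbT.
  exists (exist _ (n.+1, (g, r')) r'0); split => //=.
    move=> h gh s /=; rewrite (splitr e).
    apply: le_trans (dist_triangle dm (g s) _ _) _.
    by apply: lerD; [exact: ltW|exact: le_trans (gh s) _].
  by move=> h gh; apply: gr => s; exact: le_lt_trans (gh s) _.
have c0 : continuous (fun _ : cantor_space => 0 : X) by move=> s; exact: cvg_cst.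
pose f0 : C := mkcts c0.
have [p [p0 pS]] := dependent_choice stepP (exist _ (0%N, (f0, 1 : R)) ltr01).
pose f n := (sval (p n)).2.1; pose r n := (sval (p n)).2.2.
have pn n : (sval (p n)).1 = n.
  by elim: n => [|n IHn]; [rewrite p0|have [-> _ _ _] := pS n; rewrite IHn].
have r0 n : 0 < r n := svalP (p n).
have fm n m : (n <= m)%N -> ball (f m, r m) `<=` ball (f n, r n).
  elim: m => [|m IHm]; first by rewrite leqn0 => /eqP ->.
  rewrite leq_eqVlt => /predU1P[-> //|/IHm]; apply: subset_trans.
  by have [_ _ H _] := pS m; move: H; rewrite /f /r; do 2 case: (sval _) => ? [].
have rn n : r n <= n.+1%:R^-1.
  by apply: halving_le_natSinv => [|k]; [rewrite /r p0|have [_ ? _ _] := pS k].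
have small e : 0 < e -> exists n, r n < e.
  by move=> /small_natSinv[n ne]; exists n; exact: le_lt_trans (rn n) ne.
have dfm n m s : (n <= m)%N -> d (f n s) (f m s) <= r n.
  by move=> nm; apply: (fm _ _ nm) => t; rewrite /= (distxx dm) ltW.
have /choice[l lP] : forall s, exists l : X, (fun n => f n s) @ \oo --> l.
  move=> s; apply: cX => e e0.
  have [N HN] := small _ (divr_gt0 e0 (ltr0Sn R 1)); exists N => m n Nm Nn.
  rewrite (splitr e); apply: le_lt_trans (dist_triangle dm (f N s) _ _) _.
  by rewrite (distC dm) ltrD// (le_lt_trans _ HN)// dfm.
have dfl n s : d (f n s) (l s) <= r n.
  rewrite leNgt; apply/negP => H.
  have e0 : 0 < d (f n s) (l s) - r n by rewrite subr_gt0.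
  have [N _ HN] := lP s _ (nbhs_dist dX (l s) e0).
  have := HN (maxn N n) (leq_maxl _ _); have := dfm n _ s (leq_maxr N n).
  have := dist_triangle dm (f (maxn N n) s) (f n s) (l s).
  by rewrite /= (distC dm (l s)); lra.
have cl : continuous l.
  move=> s U /(nbhs_distP dX)[e e0 eU].
  have e30 : 0 < e / 3 by rewrite divr_gt0.
  have [n rne] := small _ e30.
  have H : nbhs s [set t | d (f n s) (f n t) < e / 3].
    exact: (@cts_fun _ _ (f n) s _ (nbhs_dist dX (f n s) e30)).
  apply: filterS H => t /= st.
  apply: eU; have := dist_triangle dm (f n s) (l s) (l t).
  have := dist_triangle dm (f n t) (f n s) (l t).
  by have := dfl n s; have := dfl n t; rewrite (distC dm (l s) (f n s)); lra.
exists (mkcts cl); apply: contrapT => /SF[n _ Fn].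
have [_ _ _] := pS n; rewrite pn => /(_ (mkcts cl)); apply => // s.
exact: dfl.
Qed.

End Generic_maps.

(** * The ordinal omega + 1 *)

Local Notation omega1 := (order_topology omega_succ).

Lemma omega_succ_max_ge (x : omega1) : ((None : omega1) < x)%O = false.
Proof. by case: x. Qed.

Lemma omega_succ_lt_nat m k : ((Some m : omega1) < (Some k : omega1))%O = (m < k)%N.
Proof. by rewrite ltn_neqAle eq_sym. Qed.

Lemma omega_succ_nbhs_max (U : set omega1) : nbhs (None : omega1) U ->
  exists N, forall k, (N <= k)%N -> U (Some k).
Proof.
have above (x : omega1) : (x < (None : omega1))%O ->
    exists N, forall k, (N <= k)%N -> (x < (Some k : omega1))%O.
  by case: x => [m _|//]; exists m.+1 => k; rewrite omega_succ_lt_nat.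
rewrite itv_nbhsE => -[[a b] [/= ab iab] abU].
suff [N HN] : exists N, forall k, (N <= k)%N -> (Some k : omega1) \in Interval a b.
  by exists N => k /HN; exact: abU.
move: a b ab iab {abU} => [[] a|[]] [[] b|[]]; rewrite /itv_open_ends //= ?in_itv //=.
- by move=> _; rewrite omega_succ_max_ge andbF.
- by move=> _; rewrite andbT => /above[N HN]; exists N => k /HN; rewrite in_itv /= andbT.
- by move=> _; rewrite omega_succ_max_ge.
- by move=> _ _; exists 0%N => k _; rewrite in_itv.
Qed.

Lemma nbhs_omega_succ_max n : nbhs (None : omega1) [set x | forall k, x = Some k -> (n < k)%N].
Proof.
apply: (@filterS _ _ _ `](Some n : omega1), +oo[%classic).
  by move=> x /= + k xk; rewrite xk in_itv /= andbT omega_succ_lt_nat.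
by apply: open_nbhs_nbhs; split; [exact: rray_open|rewrite /= in_itv].
Qed.

Lemma nbhs_omega_succ_nat k : nbhs (Some k : omega1) [set Some k].
Proof.
have nk : nbhs (Some k : omega1) `]-oo, (Some k.+1 : omega1)[%classic.
  by apply: open_nbhs_nbhs; split; [exact: lray_open|rewrite /= in_itv /= omega_succ_lt_nat].
case: k nk => [|k] nk.
  by apply: filterS nk => -[j|]; rewrite /= in_itv //= omega_succ_lt_nat ltnS leqn0 => /eqP ->.
have nk' : nbhs (Some k.+1 : omega1) `](Some k : omega1), +oo[%classic.
  by apply: open_nbhs_nbhs; split; [exact: rray_open|rewrite /= in_itv /= omega_succ_lt_nat ltnSn].
apply: filterS (filterI nk nk') => -[j|] []; rewrite /= !in_itv //= !omega_succ_lt_nat andbT.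
by move=> jk kj; congr Some; apply/eqP; rewrite eqn_leq -ltnS jk.
Qed.

(** The number [k] is sent to the sequence whose only nonzero term is the
    [k]-th, the largest element to the zero sequence. *)
Definition omega_succ_cantor (x : omega1) : cantor_space :=
  fun i => if x is Some k then i == k else false.

Lemma omega_succ_cantor_inj : injective omega_succ_cantor.
Proof.
have neq k (y : omega1) : omega_succ_cantor (Some k) = omega_succ_cantor y -> Some k = y.
  move=> /(congr1 (fun s : cantor_space => s k)); rewrite /omega_succ_cantor eqxx.
  by case: y => // l /esym/eqP ->.
by move=> [k|] [l|] //; [exact: neq|exact: neq|move=> /esym/neq].
Qed.

Lemma omega_succ_cantor_continuous : continuous omega_succ_cantor.
Proof.
move=> [k|] U nU.
  by apply: filterS (nbhs_omega_succ_nat k) => _ ->; exact: nbhs_singleton.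
have [n nU'] := cylinder_nbhs nU.
apply: filterS (nbhs_omega_succ_max n) => x xn; apply: nU' => i ni.
case: x xn => // k /(_ k erefl) nk; rewrite /omega_succ_cantor.
by apply: ltn_eqF; exact: ltn_trans nk.
Qed.

(** * Maps witnessing smallness *)

Section Smallness.
Variables (R : realType) (X : topologicalLmodType R).
Implicit Types A : set X.

Lemma in_translate A x y : translate A x y <-> A (y - x).
Proof.
split=> [[a Aa <-]|Axy]; first by rewrite addrK.
by exists (y - x) => //; rewrite subrK.
Qed.

(** The sequences with one nonzero term tend to the zero sequence, and a thin
    set that contains the latter contains none of them. *)
Lemma haar_thin_not_nbhs A : haar_thin A -> ~ nbhs (0 : X) (diff_set A A).
Proof.
move=> [f cf thinA] nA; pose s0 : cantor_space := fun=> false.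
have [n nf] : exists n, cylinder s0 n `<=` [set t | diff_set A A (f t - f s0)].
  apply: cylinder_nbhs.
  have /= := @cvg_subr R X _ (nbhs s0) f (fun=> f s0) (f s0) (f s0) _ (cf s0) (cvg_cst _).
  by rewrite subrr; exact.
pose s : cantor_space := fun i => i == n.
have [a Aa [b Ab ab]] : diff_set A A (f s - f s0).
  by apply: nf => i ni; rewrite /s ltn_eqF.
have : s = s0.
  apply: (thinA (f s - a) n); rewrite ?inE /=.
  - by apply/in_translate; rewrite subKr.
  - apply/in_translate; suff -> : f s0 - (f s - a) = b by [].
    by rewrite opprB addrCA -[f s0 - f s]opprB -ab opprB addrC subrK.
  by apply/funext => -[i ni] /=; rewrite /s (negPf ni).
by move=> /(congr1 (fun t : cantor_space => t n)); rewrite /s eqxx.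
Qed.

(** The differences of [n + 1] late terms and the limit are small enough to have
    a common translate in [A]. *)
Lemma null_n_not_nbhs A n : convex_set A -> null_n n A ->
  ~ nbhs (0 : X) (diff_set A A).
Proof.
move=> convA [f cf nullA] nA.
have [U U0 AU] := common_translate convA n.+1 nA.
have [N fN] : exists N, forall k, (N <= k)%N -> U (f (Some k) - f None).
  apply: (@omega_succ_nbhs_max [set t | U (f t - f None)]).
  have /= := @cvg_subr R X _ (nbhs (None : order_topology omega_succ)) f
    (fun=> f None) (f None) (f None) _ (cf None) (cvg_cst _).
  by rewrite subrr; apply.
have [x Ax] := AU (fun i => f (Some (N + i)%N) - f None) (fun i => fN _ (leq_addr i N)).
pose g (i : nat) : order_topology omega_succ := Some (N + i)%N.
have gI : `I_n.+1 #<= g @` `I_n.+1.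
  have ginj : {in `I_n.+1 &, injective g} by move=> i j _ _ [/addnI].
  by have := inj_card_eq ginj; rewrite card_eq_le => /andP[].
have gf : g @` `I_n.+1 #<= `I_n.
  apply: card_le_trans (nullA (f None - x)); apply: subset_card_le => _ [i /= ni <-].
  by apply/in_translate; rewrite opprB addrA addrAC; exact: (Ax (Ordinal ni)).
by have := card_le_trans gI gf; rewrite card_le_II ltnn.
Qed.

Lemma haar1_map A : polish R X -> generically_haar1 A ->
  exists2 f : cantor_space -> X, continuous f &
    forall x, f @^-1` translate A x #<= `I_1.
Proof.
move=> [_ [d [dm dX cX]]] /(comeager_nonempty dm dX cX)[f f1].
by exists f => //; exact: cts_fun.
Qed.

Lemma haar1_haar_thin A : polish R X -> generically_haar1 A -> haar_thin A.
Proof.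
move=> pX /(haar1_map pX)[f cf f1]; exists f => // x n s t /set_mem fs /set_mem ft _.
by have /card_le1P := f1 x; apply.
Qed.

Lemma haar1_haar_countable A :
  polish R X -> generically_haar1 A -> haar_countable A.
Proof.
move=> pX /(haar1_map pX)[f cf f1]; exists f => // x.
by apply: finite_set_countable; apply: card_le_finite (f1 x) _; exact: finite_II.
Qed.

Lemma haar1_null1 A : polish R X -> generically_haar1 A -> null_n 1 A.
Proof.
move=> pX /(haar1_map pX)[f cf f1]; exists (f \o omega_succ_cantor).
  move=> x; apply: continuous_comp; last exact: cf.
  exact: omega_succ_cantor_continuous.
move=> x; apply/card_le1P => y z fy fz; apply: omega_succ_cantor_inj.
by have /card_le1P := f1 x; apply.
Qed.

Lemma null_n_null_finite n A : null_n n A -> null_finite A.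
Proof.
move=> [f cf fn]; exists f => // x.
by apply: card_le_finite (fn x) _; exact: finite_II.
Qed.

End Smallness.

(** * Localization of difference sets *)

Section Local.
Variables (R : realType) (X : topologicalLmodType R).
Hypothesis polishX : polish R X.
Implicit Types (A B : set X).

Lemma polish_hausdorff : hausdorff_space X.
Proof. by have [_ [d [dm dX _]]] := polishX; exact: metric_hausdorff dm dX. Qed.

Lemma polish_countable_basis : exists B : nat -> set X, countable_basis B.
Proof.
have [sX [d [dm dX _]]] := polishX.
have [noX|[a aX]] := separable_dense_sequence sX; first by case: (noX 0).
exact (metric_countable_basis dm dX aX).
Qed.

Lemma meager_diff_not_nbhs A :
  meager (diff_set A A) -> ~ nbhs (0 : X) (diff_set A A).
Proof.
have [_ [d [dm dX _]]] := polishX => mA.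
exact: haar_thin_not_nbhs (haar1_haar_thin polishX (meager_generically_haar1 dm dX mA)).
Qed.

Lemma not_nbhs_diff_meager A : souslin A -> convex_set A ->
  ~ nbhs (0 : X) (diff_set A A) -> meager (diff_set A A).
Proof.
move=> sA convA; have [B bB] := polish_countable_basis.
exact (diff_set_meager convA bB polish_hausdorff sA).
Qed.

Lemma closed_nbhs_half (V : set X) : nbhs 0 V -> exists W : set X,
  [/\ nbhs 0 W, closed W & forall x y, W x -> W y -> V (x + y)].
Proof.
have [_ [d [dm dX _]]] := polishX => nV.
have nV' : nbhs ((0 : X) + 0) V by rewrite addr0.
have [[U1 U2] [/= nU1 nU2] U12] := @add_continuous X (0, 0) _ nV'.
have [e e0 eU] := nbhs_distP dX (filterI nU1 nU2).
have e20 := divr_gt0 e0 (ltr0Sn R 1).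
have eW y : d 0 y <= e / 2 -> U1 y /\ U2 y.
  by move=> ye; apply: eU; lra.
exists [set y | d 0 y <= e / 2]; split.
- by apply: filterS (nbhs_dist dX 0 e20) => y /ltW.
- exact: closed_dist_ball.
by move=> x y /eW[? _] /eW[_ ?]; exact: (U12 (x, y)).
Qed.

(** The part [C n] of [A] that contractions towards [a0] by factors of at most
    [1 / (n + 1)] take into [a0 + W] increases to [A] with [n], so one of the sets
    [C n - C n] is not meager, and Pettis' theorem applies to it. Contracting
    four elements of [C n] towards [a0] brings them near [a0], while convexity
    keeps the means of two of them in [A]. *)
Lemma diff_nbhs_local A (a0 : X) (V : set X) : souslin A -> convex_set A ->
  nbhs 0 (diff_set A A) -> A a0 -> nbhs 0 V ->
  nbhs 0 (diff_set (A `&` [set a | V (a - a0)]) (A `&` [set a | V (a - a0)])).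
Proof.
move=> sA convA nA Aa0 nV.
have [W [nW cW WV]] := closed_nbhs_half nV.
pose C n := A `&` [set a | forall t : R, 0 <= t -> t <= n.+1%:R^-1 -> W (t *: (a - a0))].
have sC n : souslin (C n).
  apply: souslinI_closed => //.
  rewrite (_ : [set a | _] = \bigcap_(t in [set t : R | 0 <= t /\ t <= n.+1%:R^-1])
      [set a | W (t *: (a - a0))]); last first.
    apply/seteqP; split=> [a Ca t [t0 tn]|a Ca t t0 tn]; first exact: Ca.
    by apply: (Ca t); split.
  apply: closed_bigI => t _.
  apply: (@closed_comp _ _ (fun a => t *: (a - a0)) W) => // a _.
  apply: (@continuous_comp _ _ _ (+%R^~ (- a0)) ( *:%R t)).
    exact: addr_continuous.
  exact: scaler_continuous.
have Cle m n : (m <= n)%N -> C m `<=` C n.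
  move=> mn a [Aa Ca]; split => // t t0 tn; apply: Ca => //; apply: le_trans tn _.
  by rewrite lef_pV2 ?posrE ?ltr0Sn// ler_nat ltnS.
have AC a : A a -> exists n, C n a.
  move=> Aa; have n0 : \forall t \near (0 : R^o), W (t *: (a - a0)).
    have /= := @cvg_scaler R X _ (nbhs (0 : R^o)) id (fun=> a - a0) 0 _ _ cvg_id (cvg_cst _).
    by rewrite scale0r; exact.
  have [e /= e0 eW] := n0; have [n ne] := small_natSinv e0.
  exists n; split => // t t0 tn; apply: eW.
  by rewrite /= sub0r normrN ger0_norm//; exact: le_lt_trans ne.
have [n nmC] : exists n, ~ meager (diff_set (C n) (C n)).
  apply: contrapT => /forallNP H; apply: meager_diff_not_nbhs nA.
  apply: meagerS (meager_bigcup (fun n => contrapT (H n))).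
  move=> _ [a /AC[m Ca] [b /AC[k Cb] <-]]; exists (maxn m k) => //.
  exists a; first exact: Cle (leq_maxl m k) _ Ca.
  by exists b => //; exact: Cle (leq_maxr m k) _ Cb.
have [B bB] := polish_countable_basis.
have nE := souslin_diff_nbhs bB polish_hausdorff (souslin_diff (sC n)) nmC.
pose e : R := n.+1%:R^-1; pose e2 := e / 2.
have e0 : 0 < e by rewrite invr_gt0.
have e1 : e <= 1 by rewrite invf_le1 ?ler1n.
have e20 : 0 < e2 by rewrite divr_gt0.
have e2e : e2 <= e by rewrite ler_pdivrMr// ler_pMr// ler1n.
have near_mean a b : C n a -> C n b ->
    let p := a0 + e2 *: ((a - a0) + (b - a0)) in A p /\ V (p - a0).
  move=> [Aa Ca] [Ab Cb] /=; split.
    have -> : a0 + e2 *: (a - a0 + (b - a0)) = e *: (2^-1 *: (a + b)) + (1 - e) *: a0.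
      rewrite addrACA -opprD scalerBr -mulr2n -scaler_nat 2!scalerA divfK ?pnatr_eq0//.
      by rewrite scalerBl scale1r addrCA.
    by apply: convexE => //; [exact: ltW|exact: convex_mid].
  by rewrite addrC addKr scalerDr; apply: WV; [apply: Ca|apply: Cb] => //; exact: ltW.
apply: filterS (nbhs0_scale e2^-1 nE) => v /=.
move=> [_ [a Ca [b Cb <-]] [_ [a' Ca' [b' Cb' <-]] ev]].
have [Ap Vp] := near_mean _ _ Ca Cb'; have [Aq Vq] := near_mean _ _ Ca' Cb.
exists (a0 + e2 *: ((a - a0) + (b' - a0))) => //.
exists (a0 + e2 *: ((a' - a0) + (b - a0))) => //.
rewrite opprD addrACA subrr add0r -scalerBr.
have -> : a - a0 + (b' - a0) - (a' - a0 + (b - a0)) = a - b - (a' - b').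
  have mean x y : x - a0 + (y - a0) = x + y - (a0 + a0) by rewrite addrACA -opprD.
  rewrite !mean [in LHS]opprB [in LHS]addrA subrK opprB [in RHS]addrACA.
  by rewrite -opprD (addrC b).
by rewrite ev scalerA mulfV ?scale1r ?gt_eqF.
Qed.

(** For small [u] the vectors [0], [u], [v], [u + v] have a common translate
    in [A] whenever [v] is small, which makes [v] a difference of two elements
    of [A] that stay in [A] when moved by [u]. *)
Lemma diff_nbhs_shift A (z : X) (V : set X) : souslin A -> convex_set A ->
  nbhs 0 (diff_set A A) -> A z -> nbhs z V ->
  exists2 U, nbhs 0 U & forall u, U u ->
    let A' := A `&` [set y | A (y + u)] in
    nbhs 0 (diff_set A' A') /\ (A' `&` V) !=set0.
Proof.
move=> sA convA nA Az nV.
have [U U0 AU] := common_translate convA 4 nA.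
have [W [nW _ WU]] := closed_nbhs_half U0.
have W0 := nbhs_singleton nW.
have WsubU x : W x -> U x by move=> Wx; rewrite -[x]addr0; exact: WU.
have nL := diff_nbhs_local sA convA nA Az (nbhs0_shift nV).
exists (W `&` diff_set (A `&` [set a | V (z + (a - z))]) (A `&` [set a | V (z + (a - z))])).
  exact: filterI.
move=> u [Wu [a [Aa _] [b [Ab /= Vb] abu]]]; split; last first.
  exists b; split; last by rewrite addrC subrK in Vb.
  by split=> //=; rewrite -abu addrC subrK.
apply: filterS nW => v Wv.
have [|x Ax] := AU (fun i : 'I_4 => nth 0 [:: 0; u; v; u + v] i).
  by case=> -[|[|[|[|//]]]] /= _; [exact: WsubU|exact: WsubU|exact: WsubU|exact: WU].
have A0 := Ax (@Ordinal 4 0 isT); have A1 := Ax (@Ordinal 4 1 isT).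
have A2 := Ax (@Ordinal 4 2 isT); have A3 := Ax (@Ordinal 4 3 isT).
rewrite /= add0r in A0; rewrite /= in A1 A2 A3.
exists (v + x); first by split => //=; rewrite addrAC (addrC v).
exists x; first by split => //=; rewrite addrC.
by rewrite addrK.
Qed.

End Local.

(** * Infinite systems of translates of a G-delta set *)

Section Gdelta.
Variables (R : realType) (X : topologicalLmodType R).
Hypothesis polishX : polish R X.

Section Translates.
Variables (A : set X) (T : topologicalType) (f : T -> X).
Hypotheses (sA : souslin A) (convA : convex_set A).

Definition shifts (h : seq T) : set X := [set y | forall t, t \in h -> A (y + f t)].

Lemma shifts_cons t h : shifts (t :: h) = [set y | A (y + f t)] `&` shifts h.
Proof.
apply/seteqP; split=> [y hy|y [Ay hy] s]; last by rewrite inE => /predU1P[->|/hy].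
by split=> [|s sh]; apply: hy; rewrite inE ?eqxx// sh orbT.
Qed.

Lemma shifts1 t : shifts [:: t] = [set y | A (y + f t)].
Proof. by rewrite shifts_cons (_ : shifts [::] = setT) ?setIT//; apply/seteqP; split. Qed.

Lemma shift_image t : [set y | A (y + f t)] = (+%R^~ (- f t)) @` A.
Proof.
apply/seteqP; split=> [y Ay|_ [a Aa <-]]; first by exists (y + f t); rewrite ?addrK.
by rewrite /= subrK.
Qed.

Lemma souslin_shifts t h : souslin (shifts (t :: h)).
Proof.
have s1 s : souslin [set y | A (y + f s)].
  by rewrite shift_image; apply: souslin_image => //; exact: addr_continuous.
elim: h t => [|s h IHh] t; first by rewrite shifts1.
by rewrite shifts_cons; apply: souslinI => //; exact: polish_hausdorff.
Qed.

Lemma convex_shifts h : convex_set (shifts h).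
Proof.
move=> x y l /set_mem hx /set_mem hy; apply/mem_set => t th.
suff -> : conv l x y + f t = l%:num *: (x + f t) + (1 - l%:num) *: (y + f t).
  by apply: convexE => //; [exact: hx|exact: hy].
rewrite !scalerDr addrACA -scalerDl addrC [in RHS]addrC; congr (_ + _).
by rewrite addrC subrK scale1r.
Qed.

End Translates.

(** The points [t0, t1, ...] are chosen one at a time, each one close to an
    earlier point [sel h], where [h] lists the points chosen so far in reverse
    order; [Q] collects the further requirements. The set [shifts A f h]
    keeps the property that its difference set is a neighbourhood of zero, and
    the approximations of [z] stay in balls that guarantee membership of
    [z + f t] in more and more of the open sets whose intersection is [A]. *)
Lemma Gdelta_common_shift (A : set X) (T : topologicalType) (f : T -> X) (t0 : T)
    (sel : seq T -> T) (Q : seq T -> T -> Prop) :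
  souslin A -> convex_set A -> Gdelta A -> nbhs 0 (diff_set A A) ->
  continuous f -> (forall h, sel h \in t0 :: h) ->
  (forall h U, nbhs (sel h) U -> exists2 t, U t & Q h t) ->
  exists z (u : nat -> seq T), [/\ u 0%N = [:: t0],
    forall n, exists2 t, u n.+1 = t :: u n & Q (u n) t &
    forall n t, t \in u n -> A (z + f t)].
Proof.
move=> sA convA [G oG AG] nA cf selP QP.
have [_ [d [dm dX cX]]] := polishX.
pose good (p : nat * (seq T * (X * R))) := [/\ t0 \in p.2.1,
  shifts A f p.2.1 p.2.2.1, nbhs 0 (diff_set (shifts A f p.2.1) (shifts A f p.2.1)) &
  0 < p.2.2.2].
pose ball (p : X * R) := [set y | d p.1 y <= p.2].
pose step (p q : {p | good p}) := [/\
  (sval q).1 = (sval p).1.+1,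
  exists2 t, (sval q).2.1 = t :: (sval p).2.1 & Q (sval p).2.1 t,
  ball (sval q).2.2 `<=` ball (sval p).2.2,
  (sval q).2.2.2 <= (sval p).2.2.2 / 2 &
  forall y (m : 'I_(sval p).1) t, ball (sval q).2.2 y -> t \in (sval q).2.1 ->
    G m (y + f t)].
have stepP p : {q | step p q}.
  apply: cid; case: p => -[n [h [z r]]] /= [/= t0h hz nh r0].
  have sh : sel h \in h by have := selP h; rewrite inE => /predU1P[->|].
  have [t1 [h1 hE]] : exists t1 h1, h = t1 :: h1.
    by case: (h) t0h => [//|t1 h1] _; exists t1, h1.
  have sB : souslin (shifts A f h) by rewrite hE; exact: souslin_shifts.
  have r20 := divr_gt0 r0 (ltr0Sn R 1).
  have [U nU HU] := diff_nbhs_shift polishX sB (@convex_shifts _ _ f convA h) nh hz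
    (nbhs_dist dX z r20).
  have [t /HU[nB' [z' [[hz' hz'u] zz']]] Qt] : exists2 t, U (f t - f (sel h)) & Q h t.
    apply: (QP h [set t | U (f t - f (sel h))]).
    have /= := @cvg_subr R X _ (nbhs (sel h)) f (fun=> f (sel h)) _ _ _ (cf _) (cvg_cst _).
    by rewrite subrr; exact.
  have subB : shifts A f h `&` [set y | shifts A f h (y + (f t - f (sel h)))] `<=`
      shifts A f (t :: h).
    move=> y [hy hyu]; rewrite shifts_cons; split=> //=.
    by have := hyu _ sh; rewrite -addrA subrK.
  have h'z' : shifts A f (t :: h) z' by apply: subB.
  have nO : \forall y \near z', forall (p : 'I_n * seq_sub (t :: h)),
      G p.1 (y + f (ssval p.2)).
    apply: filter_forall => -[m [s sth]] /=.
    apply: (@addr_continuous R X (f s) z' (G m)); apply: open_nbhs_nbhs.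
    by split; [exact: oG|have := h'z' s sth; rewrite AG; exact].
  have [e e0 eO] := nbhs_distP dX nO.
  pose r' := Num.min (e / 2) (r / 2).
  have r'0 : 0 < r' by rewrite lt_min r20 divr_gt0.
  have r're : r' <= e / 2 by rewrite ge_min lexx.
  have r'r : r' <= r / 2 by rewrite ge_min lexx orbT.
  have gq : good (n.+1, (t :: h, (z', r'))).
    split => //=; first by rewrite inE t0h orbT.
    by apply: filterS nB'; exact: diff_setS.
  exists (exist _ _ gq); split => //=.
  - by exists t.
  - move=> y; rewrite /ball /mkset /= => z'y; have := dist_triangle dm z' z y.
    by move: zz'; rewrite /mkset; lra.
  - move=> y m s; rewrite /ball /mkset /= => z'y sth.
    by apply: (eO y _ (m, SeqSub sth)); lra.
have [a Aa] : exists a, A a by have [a Aa _] := nbhs_singleton nA; exists a.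
have g0 : good (0%N, ([:: t0], (a - f t0, 1))).
  split=> //=; first exact: mem_head.
    by rewrite shifts1 /= subrK.
  apply: filterS nA => _ [b Ab [c Ac <-]].
  rewrite /= shifts1; exists (b - f t0); first by rewrite /mkset subrK.
  exists (c - f t0); first by rewrite /mkset subrK.
  by rewrite opprD addrACA subrr addr0.
have [p [p0 pS]] := dependent_choice stepP (exist _ _ g0).
pose z n := (sval (p n)).2.2.1; pose r n := (sval (p n)).2.2.2.
pose u n := (sval (p n)).2.1.
have pn n : (sval (p n)).1 = n.
  by elim: n => [|n IHn]; [rewrite p0|have [-> _ _ _ _] := pS n; rewrite IHn].
have uS n : exists2 t, u n.+1 = t :: u n & Q (u n) t by have [_ H _ _ _] := pS n.
have r0 n : 0 < r n by have [_ _ _] := svalP (p n).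
have zm n m : (n <= m)%N -> ball (z m, r m) `<=` ball (z n, r n).
  elim: m => [|m IHm]; first by rewrite leqn0 => /eqP ->.
  rewrite leq_eqVlt => /predU1P[-> //|/IHm]; apply: subset_trans.
  by have [_ _ H _ _] := pS m; move: H; rewrite /z /r; do 2 case: (sval _) => ? [? []].
have rn n : r n <= n.+1%:R^-1.
  by apply: halving_le_natSinv => [|k]; [rewrite /r p0|have [_ _ _ ? _] := pS k].
have dzm n m : (n <= m)%N -> d (z n) (z m) <= r n.
  by move=> nm; apply: (zm _ _ nm); rewrite /ball /= (distxx dm) ltW.
have [l zl] : exists l : X, z @ \oo --> l.
  apply: cX => e e0; have [N Ne] := small_natSinv (divr_gt0 e0 (ltr0Sn R 1)).
  have rN := le_lt_trans (rn N) Ne.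
  exists N => m n Nm Nn; have := dzm _ _ Nm; have := dzm _ _ Nn.
  by have := dist_triangle dm (z N) (z m) (z n); rewrite (distC dm (z m) (z N)); lra.
have zlr n : ball (z n, r n) l.
  apply: (@closed_dist_ball _ _ _ dm dX (z n) (r n)) => U /zl[N _ NU].
  exists (z (maxn N n)); split; first exact/dzm/leq_maxr.
  by apply: NU; exact: leq_maxl.
have u_le m n : (m <= n)%N -> {subset u m <= u n}.
  elim: n => [|n IHn]; first by rewrite leqn0 => /eqP ->.
  rewrite leq_eqVlt => /predU1P[-> //|/IHn] mn t /mn tn.
  by have [s -> _] := uS n; rewrite inE tn orbT.
exists l, u; split => //; first by rewrite /u p0.
move=> n t tn; rewrite AG => m _.
pose N := maxn n m.+1; have [_ _ _ _] := pS N.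
have mN : (m < (sval (p N)).1)%N by rewrite pn leq_maxr.
move=> /(_ l (Ordinal mN) t); apply; last exact: (u_le _ _ (leqW (leq_maxl n m.+1))).
by have := zlr N.+1; rewrite /z /r; case: (sval _) => ? [? []].
Qed.

(** Choosing every new point near the largest element of omega + 1, and different
    from the earlier ones, gives infinitely many points in one preimage. *)
Lemma null_finite_not_nbhs (A : set X) : souslin A -> convex_set A -> Gdelta A ->
  null_finite A -> ~ nbhs (0 : X) (diff_set A A).
Proof.
move=> sA convA gA [f cf finA] nA.
have [||z [u [u0 uS uA]]] := Gdelta_common_shift (t0 := (None : order_topology omega_succ))
  (sel := fun=> None) (Q := fun h t => t \notin h) sA convA gA nA cf.
- by move=> h; exact: mem_head.
- move=> h U /omega_succ_nbhs_max[N NU].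
  pose K := (\max_(t <- h) odflt 0 t)%N; exists (Some (N + K.+1)%N).
    by apply: NU; exact: leq_addr.
  apply/negP => hK; have := leq_bigmax_seq (F := odflt 0%N) _ hK (P := xpredT) isT.
  by rewrite -/K /=; lia.
have uniq_u n : uniq (u n).
  elim: n => [|n IHn]; first by rewrite u0.
  by have [t -> tu] := uS n; rewrite /= tu.
have size_u n : size (u n) = n.+1.
  elim: n => [|n IHn]; first by rewrite u0.
  by have [t -> _] := uS n; rewrite /= IHn.
have /finite_seqP[s sE] := finA (- z).
have := uniq_leq_size (uniq_u (size s)) (s2 := s).
rewrite size_u ltnn => H; suff : false by []; apply: H => t /uA At.
have : [set` s] t by rewrite -sE; apply/in_translate; rewrite opprK addrC.
by [].
Qed.

(** Given an enumeration [g], nested cylinders around points of [D] enter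
    [W n] and leave out [g n] at the [n]-th step; the latter is possible since no
    point of [D] is isolated in [D]. *)
Lemma cantor_uncountable_Gdelta (D : set cantor_space) (W : nat -> set cantor_space) :
  (forall n, open (W n)) -> D `<=` \bigcap_n W n -> D !=set0 ->
  (forall s n, D s -> exists t, [/\ D t, t <> s & cylinder s n t]) ->
  ~ countable (\bigcap_n W n).
Proof.
move=> oW DW [s0 Ds0] Dperf /pfcard_geP[W0|[g]].
  by have := DW _ Ds0; rewrite W0.
pose step (p q : {p : nat * (cantor_space * nat) | D p.2.1}) := [/\
  (sval q).1 = (sval p).1.+1, ((sval p).2.2 < (sval q).2.2)%N,
  cylinder (sval p).2.1 (sval p).2.2 (sval q).2.1 &
  forall y, cylinder (sval q).2.1 (sval q).2.2 y -> W (sval p).1 y /\ y <> g (sval p).1].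
have stepP p : {q | step p q}.
  apply: cid; case: p => -[n [s k]] /= Ds.
  have [t [Dt tg st]] : exists t, [/\ D t, t <> g n & cylinder s k t].
    have [sg|sg] := pselect (s = g n); last by exists s.
    by have [t [Dt ts st]] := Dperf s k Ds; exists t; split=> //; rewrite -sg.
  have [j tj] : exists j, t j <> g n j.
    by apply: contrapT => /forallNP H; apply: tg; apply/funext => j; exact: contrapT.
  have [i ti] := cylinder_nbhs (open_nbhs_nbhs (conj (oW n) (DW _ Dt n I))).
  exists (exist _ (n.+1, (t, maxn k.+1 (maxn j.+1 i))) Dt); split => //=.
    exact: leq_maxl.
  move=> y ty; split.
    by apply: ti; apply: cylinder_le ty; rewrite !leq_max leqnn !orbT.
  by move=> yg; apply: tj; rewrite -yg ty// !leq_max ltnSn orbT.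
have [p [p0 pS]] := dependent_choice stepP (exist _ (0%N, (s0, 0%N)) Ds0).
pose s n := (sval (p n)).2.1; pose k n := (sval (p n)).2.2.
have pn n : (sval (p n)).1 = n.
  by elim: n => [|n IHn]; [rewrite p0|have [-> _ _ _] := pS n; rewrite IHn].
have nk n : (n <= k n)%N.
  elim: n => // n IHn; have [_ H _ _] := pS n; exact: leq_ltn_trans H.
have skS n : cylinder (s n.+1) (k n.+1) `<=` cylinder (s n) (k n).
  have [_ kk sk _] := pS n; rewrite -(cylinder_eq sk).
  by apply: cylinder_le; exact: ltnW.
have sk n m : (n <= m)%N -> cylinder (s m) (k m) `<=` cylinder (s n) (k n).
  elim: m => [|m IHm]; first by rewrite leqn0 => /eqP ->.
  by rewrite leq_eqVlt => /predU1P[-> //|/IHm]; apply: subset_trans; exact: skS.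
pose y : cantor_space := fun i => s i.+1 i.
have sy n : cylinder (s n) (k n) y.
  move=> i ik; rewrite /y; have [ni|ni] := leqP n i.+1.
    exact: (sk _ _ ni (s i.+1)).
  by apply/esym/(sk _ _ (ltnW ni) (s n)) => //; exact: nk.
have Wy n : W n y /\ y <> g n by have [_ _ _] := pS n; rewrite pn; apply; exact: sy.
have [n _ gn] : (g @` setT) y by apply: 'surj_g => n _; exact: (Wy n).1.
by have [_] := Wy n; rewrite gn.
Qed.

(** Each chosen point is selected infinitely often, and each time a new point is
    chosen closer to it, so that the chosen points form a dense-in-itself
    set. The 2-adic valuation of the number of chosen points serves to
    select each index infinitely often. *)
Lemma haar_countable_not_nbhs (A : set X) : souslin A -> convex_set A -> Gdelta A ->
  haar_countable A -> ~ nbhs (0 : X) (diff_set A A).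
Proof.
move=> sA convA gA [f cf cntA] nA.
pose t0 : cantor_space := fun=> false.
pose sel (h : seq cantor_space) := nth t0 (rev h) (logn 2 (size h)).
pose Q (h : seq cantor_space) t := t <> sel h /\ cylinder (sel h) (size h) t.
have [||z [u [u0 uS uA]]] := Gdelta_common_shift (t0 := t0)
  (sel := sel) (Q := Q) sA convA gA nA cf.
- move=> h; rewrite /sel inE; have [hs|hs] := ltnP (logn 2 (size h)) (size (rev h)).
    by rewrite -[in _ \in h]mem_rev mem_nth// orbT.
  by rewrite nth_default// eqxx.
- move=> h U /cylinder_nbhs[n nU]; pose N := maxn n (size h).
  pose t : cantor_space := fun i => if i == N then ~~ sel h i else sel h i.
  have tc : cylinder (sel h) N t by move=> i iN; rewrite /t ltn_eqF.
  exists t; first by apply/nU/(cylinder_le (leq_maxl _ _) tc).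
  split; last exact: (cylinder_le (leq_maxr _ _) tc).
  by move=> /(congr1 (fun s : cantor_space => s N)); rewrite /t eqxx; case: (sel h N).
have size_u n : size (u n) = n.+1.
  elim: n => [|n IHn]; first by rewrite u0.
  by have [t -> _] := uS n; rewrite /= IHn.
have nth_u i n m : (i <= n)%N -> (n <= m)%N -> nth t0 (rev (u m)) i = nth t0 (rev (u n)) i.
  move=> ni; elim: m => [|m IHm]; first by rewrite leqn0 => /eqP ->.
  rewrite leq_eqVlt => /predU1P[-> //|nm]; rewrite -IHm//.
  have [t -> _] := uS m; rewrite rev_cons nth_rcons size_rev size_u ifT//.
  by rewrite ltnS (leq_trans ni).
have [G oG AG] := gA.
pose D := [set t | exists n, t \in u n].
pose W n := [set t | G n (z + f t)].
apply: (@cantor_uncountable_Gdelta D W).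
- move=> n; apply: (@open_comp _ _ (fun t => z + f t) (G n)) => // t _.
  by apply: cvg_addr; [exact: cvg_cst|exact: cf].
- by move=> t [n tn] m _; have := uA n t tn; rewrite AG; exact.
- by exists t0, 0%N; rewrite u0 mem_head.
- move=> s m [n sn].
  have [i ni si] : exists2 i, (i <= n)%N & nth t0 (rev (u n)) i = s.
    exists (index s (rev (u n))); last by rewrite nth_index// mem_rev.
    by rewrite -ltnS -(size_u n) -size_rev index_mem mem_rev.
  (* an odd multiple of [2 ^ i], at which the [i]-th point is selected *)
  pose k := (2 ^ i * (2 * maxn n m).+1)%N.
  have [t tE [ts st]] := uS k.-1.
  have k0 : (0 < k)%N by rewrite muln_gt0 expn_gt0.
  have kn : (maxn n m < k)%N.
    by apply: (@leq_trans (2 * maxn n m).+1); [lia|rewrite leq_pmull ?expn_gt0].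
  have selE : sel (u k.-1) = s.
    rewrite /sel size_u prednK// /k lognM ?expn_gt0// pfactorK//.
    rewrite (@lognE 2 (2 * _).+1) /= dvdn2 /= oddM /= addn0 (nth_u i n)//.
    rewrite -ltnS prednK//; exact: leq_ltn_trans (leq_maxl n m) kn.
  exists t; split; [|by rewrite -selE|].
    by exists k.-1.+1; rewrite tE mem_head.
  rewrite selE size_u prednK// in st; apply: cylinder_le st.
  exact: leq_trans (leq_maxr n m) (ltnW kn).
suff -> : \bigcap_n W n = f @^-1` translate A (- z) by exact: cntA.
apply/seteqP; split=> t /=; rewrite in_translate opprK addrC AG.
  by move=> H n _; exact: H.
by move=> H n _; exact: H.
Qed.

End Gdelta.

(** * Equivalence of the smallness notions *)

Unset Implicit Arguments.

Theorem theorem20p1 (R : realType) (X : topologicalLmodType R)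
    (polishX : polish R X) (A : set X)
    (analyticA : analytic R (set_type A)) (convexA : convex_set A) :
  [<-> ~ nbhs (0 : X) (diff_set A A);
       meager (diff_set A A);
       generically_haar1 A;
       haar_thin A;
       exists2 n : nat, (1 <= n)%N & null_n n A]
  /\
  (Gdelta A ->
   [<-> ~ nbhs (0 : X) (diff_set A A);
        meager (diff_set A A);
        generically_haar1 A;
        haar_thin A;
        exists2 n : nat, (1 <= n)%N & null_n n A;
        null_finite A;
        haar_countable A]).
Proof.
have sA := analytic_souslin analyticA.
have nbhs_meager := not_nbhs_diff_meager polishX sA convexA.
have meager_haar1 : meager (diff_set A A) -> generically_haar1 A.
  have [_ [d [dm dX _]]] := polishX; exact (meager_generically_haar1 dm dX (A := A)).
have null_nbhs n : null_n n A -> ~ nbhs (0 : X) (diff_set A A).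
  exact: null_n_not_nbhs.
have thin_null : haar_thin A -> exists2 n, (1 <= n)%N & null_n n A.
  move=> /haar_thin_not_nbhs/nbhs_meager/meager_haar1 genA.
  by exists 1%N => //; exact: haar1_null1.
split; first by tfae => //; [exact: haar1_haar_thin|move=> [n _ /null_nbhs]].
move=> gA; tfae => //.
- exact: haar1_haar_thin.
- by move=> [n _]; exact: null_n_null_finite.
- move=> /(null_finite_not_nbhs polishX sA convexA gA)/nbhs_meager/meager_haar1.
  exact: haar1_haar_countable.
- exact (haar_countable_not_nbhs polishX sA convexA gA).
Qed.
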